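(* Let $T$ be an interval exchange map with admissible combinatorial data $(\mathcal{A},\pi_t,\pi_b)$, length data $(\lambda_\alpha)_{\alpha\in\mathcal{A}}$, and the Keane property. Consider the following conditions on $T$: (A) there is a constant $M$ such that $\|B(m_k,m_{k+1})\|\le M$ for all $k\ge 0$; (Z) there is a constant $M$ such that $\|B(n_k,n_{k+1})\|\le M$ for all $k\ge 0$; (D) there is a constant $c>0$ such that $\Delta(T^n)\ge \frac{c}{n}$ for all $n\ge 1$; (U) there is a constant $c>0$ such that for all $x$ in the domain of $T$, $\liminf_{n\to\infty} n\cdot|T^n(x)-x|\ge c$. Then: (i) (A) and (D) are equivalent; (ii) (D) implies (U); (iii) (U) implies (Z).
   Context: Interval exchange maps. Combinatorial data $(\mathcal{A},\pi_t,\pi_b)$ consist of a finite set $\mathcal{A}$ with $|\mathcal{A}|=d\ge 2$ and two bijections $\pi_t,\pi_b:\mathcal{A}\to\{1,\dots,d\}$; length data are positive reals $(\lambda_\alpha)_{\alpha\in\mathcal{A}}$. Put $p_\alpha=\sum_{\pi_t(\beta)<\pi_t(\alpha)}\lambda_\beta$, $q_\alpha=\sum_{\pi_b(\beta)<\pi_b(\alpha)}\lambda_\beta$, $\lambda^*=\sum_\alpha\lambda_\alpha$. The interval exchange map $T:[0,\lambda^* )\to[0,\lambda^* )$ is $T(x)=x-p_\alpha+q_\alpha$ for $x\in I_\alpha:=[p_\alpha,p_\alpha+\lambda_\alpha)$. The data are admissible if $\pi_t^{-1}(\{1,\dots,k\})\ne\pi_b^{-1}(\{1,\dots,k\})$ for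 $1\le k<d$. $T$ has the Keane property if there are no $\alpha,\beta\in\mathcal{A}$ and integer $m\ge 1$ with $T^m(p_\alpha)=p_\beta$ and $\pi_t(\beta)>1$. Rauzy–Veech induction. Let $\alpha_t,\alpha_b\in\mathcal{A}$ be defined by $\pi_t(\alpha_t)=d=\pi_b(\alpha_b)$. Define $\mathcal{R}_t(\pi_t,\pi_b)=(\pi_t,\hat\pi_b)$ where $\hat\pi_b(\alpha)=\pi_b(\alpha)$ if $\pi_b(\alpha)\le\pi_b(\alpha_t)$, $\hat\pi_b(\alpha)=\pi_b(\alpha)+1$ if $\pi_b(\alpha_t)<\pi_b(\alpha)<d$, and $\hat\pi_b(\alpha_b)=\pi_b(\alpha_t)+1$. Define $\mathcal{R}_b(\pi_t,\pi_b)=(\hat\pi_t,\pi_b)$ where $\hat\pi_t(\alpha)=\pi_t(\alpha)$ if $\pi_t(\alpha)\le\pi_t(\alpha_b)$, $\hat\pi_t(\alpha)=\pi_t(\alpha)+1$ if $\pi_t(\alpha_b)<\pi_t(\alpha)<d$, and $\hat\pi_t(\alpha_t)=\pi_t(\alpha_b)+1$. $T$ is of top type if $\lambda_{\alpha_t}\ge\lambda_{\alpha_b}$ and of bottom type if $\lambda_{\alpha_b}\ge\lambda_{\alpha_t}$ (under the Keane property equality never occurs here or at later steps). If $T$ is of top type, $\mathcal{V}(T)$ is the map induced by $T$ on $[0,\lambda^*-\lambda_{\alpha_b})$; it is the interval exchange map with combinatorial data $\mathcal{R}_t(\pi_t,\pi_b)$ and lengths $\hat\lambda_\alpha=\lambda_\alpha$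 for $\alpha\ne\alpha_t$, $\hat\lambda_{\alpha_t}=\lambda_{\alpha_t}-\lambda_{\alpha_b}$; the winner of this step is $\alpha_t$ and the loser is $\alpha_b$. If $T$ is of bottom type, $\mathcal{V}(T)$ is the map induced by $T$ on $[0,\lambda^*-\lambda_{\alpha_t})$, with combinatorial data $\mathcal{R}_b(\pi_t,\pi_b)$ and lengths $\hat\lambda_\alpha=\lambda_\alpha$ for $\alpha\ne\alpha_b$, $\hat\lambda_{\alpha_b}=\lambda_{\alpha_b}-\lambda_{\alpha_t}$; the winner is $\alpha_b$ and the loser is $\alpha_t$. The Rauzy diagram has as vertices the combinatorial data obtained from $(\pi_t,\pi_b)$ by repeatedly applying $\mathcal{R}_t,\mathcal{R}_b$, with arrows from each vertex to its images under $\mathcal{R}_t$ and $\mathcal{R}_b$, carrying the winner and loser just described. Write $T(n)=\mathcal{V}^n(T)$ and, for $m\le n$, let $\gamma(m,n)$ be the path of $n-m$ arrows from the vertex of $T(m)$ to the vertex of $T(n)$ followed by the induction. Matrices. For an arrow $\gamma$ with winner $\alpha$ and loser $\beta$, $B_\gamma=\mathbb{I}+E_{\beta\alpha}$, where $\mathbb{I}$ is the identity and $E_{\beta\alpha}$ has a single nonzero entry $1$ at position $(\beta,\alpha)$. For a path $\gamma_1\gamma_2\cdots\gamma_l$ the matrix is $B_{\gamma_l}\cdots B_{\gamma_1}$, and $B(m,n)$ denotes the matrix of $\gamma(m,n)$. The norm is $\|A\|=\sum_{i,j}|a_{ij}|$. Accelerations. (Zorich) $n_0=0$ and $n_{k+1}>n_k$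 is chosen so that $\gamma(n_k,n_{k+1})$ is the longest path (starting at step $n_k$) all of whose arrows have the same winner. (Marmi–Moussa–Yoccoz) $m_0=0$ and $m_{k+1}>m_k$ is the largest integer such that not all letters of $\mathcal{A}$ are winners of arrows of $\gamma(m_k,m_{k+1})$. Gaps. For $n\ge 1$, $\Delta(T^n)$ is the minimal distance between discontinuities of $T^n$, where the points $p_\alpha$ with $\pi_t(\alpha)>1$ are regarded as the discontinuities of $T$ and the endpoints of the interval are counted as well; i.e. $\Delta(T^n)$ is the minimal distance between two distinct points of $\{0,\lambda^*\}\cup\{T^{-j}(p_\alpha):0\le j<n,\ \pi_t(\alpha)>1\}$. *)

(* Defs.v *)
From HB Require Import structures.
From mathcomp Require Import all_boot all_order all_algebra.
From mathcomp Require Import zify.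
From mathcomp Require Import all_classical all_reals all_analysis.

Set Implicit Arguments.
Unset Strict Implicit.
Unset Printing Implicit Defensive.

Import Order.TTheory GRing.Theory Num.Theory.
Local Open Scope classical_set_scope.
Local Open Scope ring_scope.

(* [p] is a bijection from [A] onto {1, ..., #|A|}. *)
Definition is_numbering (A : finType) (p : A -> nat) : Prop :=
  [/\ injective p,
      forall a, (1 <= p a <= #|A|)%N &
      forall k, (1 <= k <= #|A|)%N -> exists a, p a = k].

Record comb_data (A : finType) := CombData {
  pi_t : A -> nat;
  pi_b : A -> nat;
  card_ge2 : (2 <= #|A|)%N;
  pi_tP : is_numbering pi_t;
  pi_bP : is_numbering pi_b }.

Section CombinatorialData.
Context {A : finType}.
Implicit Types (p : A -> nat) (pi : comb_data A).

Lemma last_letter_ex p : (2 <= #|A|)%N -> is_numbering p ->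
  exists a, p a == #|A|.
Proof.
move=> A2 [_ _ surj]; have [|a <-] := surj #|A|; last by exists a.
by rewrite leqnn andbT ltnW.
Qed.

Definition alpha_t pi : A := xchoose (last_letter_ex (card_ge2 pi) (pi_tP pi)).
Definition alpha_b pi : A := xchoose (last_letter_ex (card_ge2 pi) (pi_bP pi)).

Definition admissible pi : Prop :=
  forall k, (1 <= k < #|A|)%N ->
    pi_t pi @^-1` [set i | (1 <= i <= k)%N] <>
    pi_b pi @^-1` [set i | (1 <= i <= k)%N].

(* Moves the last letter to position [k.+1]; the last branch only concerns the
   letter [a] with [p a = #|A|]. *)
Definition move_last (k : nat) p : A -> nat := fun a =>
  if (p a <= k)%N then p a
  else if (p a < #|A|)%N then (p a).+1
  else k.+1.

Lemma move_last_numbering k p : is_numbering p -> is_numbering (move_last k p).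
Proof.
move=> [inj rng surj]; split.
- move=> a b ab; apply: inj; move: ab; rewrite /move_last.
  have := rng a; have := rng b; do !case: ifP; lia.
- by move=> a; have := rng a; rewrite /move_last; do !case: ifP; lia.
- move=> j jA; have [jk|kj] := leqP j k.
    by have [a pa] := surj j jA; exists a; rewrite /move_last pa jk.
  have [jk|jk] := eqVneq j k.+1.
    have [|a pa] := surj #|A|; first by lia.
    by exists a; rewrite /move_last pa jk ltnn; case: ifP; lia.
  have [|a pa] := surj j.-1; first by lia.
  by exists a; rewrite /move_last pa; do !case: ifP; lia.
Qed.

Definition Rauzy_t pi : comb_data A :=
  CombData (card_ge2 pi) (pi_tP pi)
    (move_last_numbering (pi_b pi (alpha_t pi)) (pi_bP pi)).

Definition Rauzy_b pi : comb_data A :=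
  CombData (card_ge2 pi)
    (move_last_numbering (pi_t pi (alpha_b pi)) (pi_tP pi)) (pi_bP pi).

(* The arrow of the Rauzy diagram issued from [arrow_src], leading to
   [Rauzy_t arrow_src] if [arrow_top] and to [Rauzy_b arrow_src] otherwise. *)
Record arrow := Arrow { arrow_src : comb_data A; arrow_top : bool }.

Definition winner (g : arrow) : A :=
  if arrow_top g then alpha_t (arrow_src g) else alpha_b (arrow_src g).

Definition loser (g : arrow) : A :=
  if arrow_top g then alpha_b (arrow_src g) else alpha_t (arrow_src g).

Definition arrow_mx (R : pzRingType) (g : arrow) : 'M[R]_#|A| :=
  1%:M + delta_mx (enum_rank (loser g)) (enum_rank (winner g)).

(* B_{g_l} ... B_{g_1} for the path g_1 ... g_l. *)
Definition path_mx (R : pzRingType) (s : seq arrow) : 'M[R]_#|A| :=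
  foldl (fun M g => arrow_mx R g *m M) 1%:M s.

Definition same_winner (s : seq arrow) : Prop :=
  exists a, all (fun g => winner g == a) s.

Definition not_all_winners (s : seq arrow) : Prop :=
  exists a, a \notin [seq winner g | g <- s].

End CombinatorialData.

Arguments arrow : clear implicits.

Definition mx_norm1 (R : numDomainType) (m n : nat) (M : 'M[R]_(m, n)) : R :=
  \sum_i \sum_j `|M i j|.

(* The lengths are arbitrary here, as Rauzy induction preserves their
   positivity only when the lengths of the two last intervals differ;
   positivity is the separate predicate [pos_len]. *)
Record iem (R : realType) (A : finType) := IEM {
  data : comb_data A;
  len : A -> R }.

Section IntervalExchange.
Context {R : realType} {A : finType}.
Implicit Types T : iem R A.

Definition pos_len T : Prop := forall a, 0 < len T a.

Definition p_ T (a : A) : R :=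
  \sum_(b | (pi_t (data T) b < pi_t (data T) a)%N) len T b.

Definition q_ T (a : A) : R :=
  \sum_(b | (pi_b (data T) b < pi_b (data T) a)%N) len T b.

Definition total_len T : R := \sum_a len T a.

Definition domain T : set R := [set x | 0 <= x < total_len T].

(* Extended by the identity outside [domain T]. *)
Definition iet_map T (x : R) : R :=
  if [pick a | p_ T a <= x < p_ T a + len T a] is Some a
  then x - p_ T a + q_ T a else x.

Definition Keane T : Prop :=
  ~ exists (a b : A) (m : nat),
      [/\ (1 <= m)%N, iter m (iet_map T) (p_ T a) = p_ T b
        & (1 < pi_t (data T) b)%N].

Definition top_type T : bool :=
  len T (alpha_b (data T)) <= len T (alpha_t (data T)).

Definition induction T : iem R A :=
  let at_ := alpha_t (data T) in
  let ab := alpha_b (data T) in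
  if top_type T then
    IEM (Rauzy_t (data T))
        (fun a => if a == at_ then len T at_ - len T ab else len T a)
  else
    IEM (Rauzy_b (data T))
        (fun a => if a == ab then len T ab - len T at_ else len T a).

Definition iem_at T (n : nat) : iem R A := iter n induction T.

Definition arrow_at T (n : nat) : arrow A :=
  Arrow (data (iem_at T n)) (top_type (iem_at T n)).

Definition gamma T (m n : nat) : seq (arrow A) :=
  [seq arrow_at T i | i <- index_iota m n].

Definition B T (m n : nat) : 'M[R]_#|A| := path_mx R (gamma T m n).

Definition largest_above (P : nat -> Prop) (m0 m : nat) : Prop :=
  [/\ (m0 < m)%N, P m & forall j, P j -> (j <= m)%N].

Definition Zorich_times T (n : nat -> nat) : Prop :=
  n 0%N = 0%N /\
  forall k, largest_above (fun j => same_winner (gamma T (n k) j))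
              (n k) (n k.+1).

Definition MMY_times T (m : nat -> nat) : Prop :=
  m 0%N = 0%N /\
  forall k, largest_above (fun j => not_all_winners (gamma T (m k) j))
              (m k) (m k.+1).

(* The discontinuities of T^n, together with the endpoints. *)
Definition disc T (n : nat) : set R :=
  [set 0] `|` [set total_len T] `|`
  [set x | domain T x /\ exists (j : nat) (a : A),
     [/\ (j < n)%N, (1 < pi_t (data T) a)%N
       & iter j (iet_map T) x = p_ T a]].

(* For positive lengths, a minimum: T is then a bijection of [domain T], so
   that [disc T n] is finite, and it contains 0 and [total_len T]. *)
Definition Delta T (n : nat) : R :=
  inf [set d | exists x y, [/\ disc T n x, disc T n y, x <> y & d = `|x - y|]].

(* In the next two definitions, the sequence of times is unique if it exists. *)
Definition condA T : Prop :=
  exists2 m, MMY_times T m &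
    exists M : R, forall k, mx_norm1 (B T (m k) (m k.+1)) <= M.

Definition condZ T : Prop :=
  exists2 n, Zorich_times T n &
    exists M : R, forall k, mx_norm1 (B T (n k) (n k.+1)) <= M.

Definition condD T : Prop :=
  exists2 c : R, 0 < c & forall n, (1 <= n)%N -> c / n%:R <= Delta T n.

Definition condU T : Prop :=
  exists2 c : R, 0 < c & forall x, domain T x ->
    (c%:E <= limn_einf (fun n =>
       (n%:R * `|iter n (iet_map T) x - x|)%:E))%E.

End IntervalExchange.

(* Main.v *)
From HB Require Import structures.
Require Import Defs.
From mathcomp Require Import all_boot all_order all_algebra.
From mathcomp Require Import zify ring lra.
From mathcomp Require Import all_classical all_reals all_analysis.

(* The map induced at step n is the first return map of T to [0, l_n), so that
   the domain is a union of disjoint towers over its intervals I_a(n), of heights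
   ret n a: the vector ret n is B(0,n) applied to (1, ..., 1), the lengths satisfy
   len(n) = len(n') B(n,n'), and the left endpoint of each I_a(n) lies on the
   backward orbit of that of I_a(0).  The Keane property excludes connections
   p_b = q_a at every step, so every letter wins infinitely often.

   A property of letters that passes from the winner to the loser of each step
   reaches all letters after 2d stretches in which every letter wins.  Applied to
   "ret >= r" and "len <= l", this compares the return times, and the lengths,
   of any two letters once the blocks of the MMY acceleration are bounded.

   (A) => (D): a bounded number of blocks after the return times exceed n, the
   discontinuities of T^n are left endpoints of levels of towers, and all lengths
   are at least of order 1/n.

   (D) => (A): by (D) an interval J whose ends are discontinuities of T^h has
   return times O(h), since the pieces of T^(j+h) around a point that does not
   return for a long time have disjoint j-th images of length at least c/(j+h).
   If a does not win in a block, then J = I_a at the beginning of the block is a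
   level of its tower at the end, which bounds all return times at the end by
   those at the beginning.

   (D) => (U): if T^n translates its piece of continuity around x by a small d,
   then an endpoint of the piece and its translate by -d are discontinuities of
   T^(2n).

   (U) => (Z): in a long block with winner w, the induced map translates I_w by a
   small fraction of its length, and this produces a recurrent point. *)

Set Implicit Arguments.
Unset Strict Implicit.
Unset Printing Implicit Defensive.

Import Order.TTheory GRing.Theory Num.Theory.
Local Open Scope ring_scope.

(** * Interval exchange maps *)

Section Cumulated.
Context {R : realType} {A : finType}.
Implicit Types (pi : A -> nat) (ln : A -> R).

(** For the two rows of the combinatorial data this is [p_] and [q_]; the lemmas on it serve both
    rows. *)
Definition cum pi ln (a : A) : R := \sum_(b | (pi b < pi a)%N) ln b.

Lemma numbering_le pi a : is_numbering pi -> (pi a <= #|A|)%N.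
Proof. by case=> _ /(_ a) /andP[]. Qed.

Lemma numbering_ge1 pi a : is_numbering pi -> (0 < pi a)%N.
Proof. by case=> _ /(_ a) /andP[]. Qed.

Lemma cum_ge0 pi ln a : (forall b, 0 < ln b) -> 0 <= cum pi ln a.
Proof. by move=> ln0; apply: sumr_ge0 => b _; apply: ltW. Qed.

Lemma cumD pi ln a : is_numbering pi ->
  cum pi ln a + ln a = \sum_(b | (pi b <= pi a)%N) ln b.
Proof.
move=> [inj _ _]; rewrite [RHS](bigD1 a) //= addrC; congr (_ + _).
apply: eq_bigl => b; rewrite [in RHS]leq_eqVlt.
have [->|ba] := eqVneq b a; first by rewrite ltnn andbF.
by rewrite andbT; case: eqP => //= /inj /eqP; rewrite (negbTE ba).
Qed.

Lemma cum_total pi ln a : is_numbering pi -> pi a = #|A| ->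
  cum pi ln a + ln a = \sum_b ln b.
Proof.
move=> pP aA; rewrite cumD //; apply: eq_bigl => b.
by rewrite aA numbering_le.
Qed.

Lemma cum_succ pi ln a b : is_numbering pi -> pi b = (pi a).+1 ->
  cum pi ln b = cum pi ln a + ln a.
Proof. by move=> pP ba; rewrite cumD // /cum ba; apply: eq_bigl => c. Qed.

Lemma cum_first pi ln a : is_numbering pi -> pi a = 1%N -> cum pi ln a = 0.
Proof.
move=> pP a1; rewrite /cum big_pred0// => b.
by have := numbering_ge1 b pP; rewrite a1; lia.
Qed.

Lemma sum_sub_le ln (P Q : pred A) : (forall b, 0 < ln b) ->
  (forall b, P b -> Q b) -> \sum_(b | P b) ln b <= \sum_(b | Q b) ln b.
Proof.
move=> ln0 PQ; rewrite [X in _ <= X](bigID P) /= (eq_bigl P).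
  by rewrite lerDl; apply: sumr_ge0 => b _; apply: ltW.
by move=> b; case: (boolP (P b)) => [/PQ ->|]; rewrite ?andbF.
Qed.

Lemma cum_lt pi ln a b : is_numbering pi -> (forall b, 0 < ln b) ->
  (pi a < pi b)%N -> cum pi ln a + ln a <= cum pi ln b.
Proof.
move=> pP ln0 ab; rewrite cumD //; apply: sum_sub_le => // c ca.
exact: leq_ltn_trans ab.
Qed.

Lemma cum_le_total pi ln a : is_numbering pi -> (forall b, 0 < ln b) ->
  cum pi ln a + ln a <= \sum_b ln b.
Proof. by move=> pP ln0; rewrite cumD //; apply: sum_sub_le. Qed.

Lemma cum_gt0 pi ln a : is_numbering pi -> (forall b, 0 < ln b) ->
  (1 < pi a)%N -> 0 < cum pi ln a.
Proof.
move=> pP ln0 a1; have [_ _ /(_ 1%N)] := pP.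
have := numbering_le a pP => aA [|b b1]; first by lia.
have /(cum_lt pP ln0) : (pi b < pi a)%N by rewrite b1.
by apply: lt_le_trans; rewrite cum_first// add0r.
Qed.

Lemma cum_uniq pi ln a b x : is_numbering pi -> (forall b, 0 < ln b) ->
  cum pi ln a <= x < cum pi ln a + ln a ->
  cum pi ln b <= x < cum pi ln b + ln b -> a = b.
Proof.
move=> pP ln0 /andP[a1 a2] /andP[b1 b2]; have [inj _ _] := pP.
apply: inj; case: (ltngtP (pi a) (pi b)) => // /(cum_lt pP ln0).
  by move=> /(lt_le_trans a2) /lt_le_trans /(_ b1); rewrite ltxx.
by move=> /(lt_le_trans b2) /lt_le_trans /(_ a1); rewrite ltxx.
Qed.

Lemma cum_cover pi ln x : (0 < #|A|)%N -> is_numbering pi ->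
  0 <= x < \sum_b ln b ->
  exists a, cum pi ln a <= x < cum pi ln a + ln a.
Proof.
move=> A0 pP /andP[x0 xL]; have [_ _ surj] := pP.
have [|a1 a1E] := surj 1%N; first by rewrite A0.
have Pa1 : cum pi ln a1 <= x by rewrite cum_first.
case: (@arg_maxnP _ a1 (fun a => cum pi ln a <= x) pi Pa1) => a Pa amax.
exists a; rewrite Pa /=; have := numbering_le a pP.
rewrite leq_eqVlt => /orP[/eqP aA|aA]; first by rewrite cum_total.
have [|b bE] := surj (pi a).+1; first by rewrite aA.
rewrite -(cum_succ _ pP bE) ltNge; apply/negP => /amax /=.
by rewrite bE /= ltnn.
Qed.

(* [w] is the winner, [l] the last letter of the row [pi] of the loser. *)
Lemma cum_move_last pi ln (w l b : A) : is_numbering pi ->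
  pi l = #|A| -> w <> l ->
  cum (move_last (pi w) pi) (fun a => if a == w then ln w - ln l else ln a) b
  = if b == l then cum pi ln w + ln w - ln l else cum pi ln b.
Proof.
move=> pP lA wl; have [inj rng _] := pP.
have piA c : c != l -> (pi c < #|A|)%N.
  move=> cl; have := numbering_le c pP; rewrite leq_eqVlt => /orP[|//].
  by rewrite -lA => /eqP /inj /eqP; rewrite (negbTE cl).
have wA : (pi w < #|A|)%N by apply: piA; apply/eqP.
have mw : move_last (pi w) pi w = pi w by rewrite /move_last leqnn.
have ml : move_last (pi w) pi l = (pi w).+1.
  by rewrite /move_last lA ltnn leqNgt wA.
rewrite /cum; case: eqVneq => [->|bl].
  rewrite -/(cum pi ln w) cumD // (eq_bigl (fun c => (pi c <= pi w)%N)); last first.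
    move=> c; rewrite ml /move_last; have [->|/piA] := eqVneq c l.
      by rewrite lA ltnn; do !case: ifP; lia.
    by do !case: ifP; lia.
  rewrite (bigD1 w) //= eqxx [in RHS](bigD1 w) //= addrAC; congr (_ + _ + _).
  by apply: eq_bigr => c /andP[_ /negbTE ->].
have [bw|wb] := leqP (pi b) (pi w).
  apply: eq_big => c.
    rewrite /move_last bw; have [->|/piA] := eqVneq c l.
      by rewrite lA; do !case: ifP; lia.
    by do !case: ifP; lia.
  have [->|//] := eqVneq c w; rewrite mw /move_last bw; lia.
have mb : move_last (pi w) pi b = (pi b).+1.
  by rewrite /move_last leqNgt wb piA.
rewrite (bigD1 l) /=; last by rewrite mb ml; lia.
rewrite (bigD1 w) /=; last by rewrite mb mw; apply/andP; split; [lia|exact/eqP].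
rewrite [in RHS](bigD1 w) //= eqxx ifN; last by apply/eqP => lw; case: wl.
rewrite addrA [ln l + _]addrC subrK; congr (_ + _).
apply: eq_big => [c|c /andP[_ /negbTE ->]//]; rewrite mb /move_last.
have [->|/[dup] cl /piA] := eqVneq c l; rewrite ?andbF ?lA ?andbT //.
  by have := piA _ bl; case: eqVneq; rewrite ?andbF ?andbT //; lia.
by case: eqVneq; rewrite ?andbF ?andbT //; do !case: ifP; lia.
Qed.

(** In its own row the winner [w] is last, so its length enters no partial sum. *)
Lemma cum_last_change pi ln (w l b : A) : is_numbering pi -> pi w = #|A| ->
  cum pi (fun a => if a == w then ln w - ln l else ln a) b = cum pi ln b.
Proof.
move=> pP wA; apply: eq_bigr => c cb; case: eqVneq => // cw.
by have := numbering_le b pP; rewrite -wA -cw; lia.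
Qed.

End Cumulated.

Section IET.
Context {R : realType} {A : finType}.
Implicit Types (T : iem R A).

Definition Iv T a x := p_ T a <= x < p_ T a + len T a.

Lemma alpha_tP (pi : comb_data A) : pi_t pi (alpha_t pi) = #|A|.
Proof. by apply/eqP/(xchooseP (last_letter_ex (card_ge2 pi) (pi_tP pi))). Qed.

Lemma alpha_bP (pi : comb_data A) : pi_b pi (alpha_b pi) = #|A|.
Proof. by apply/eqP/(xchooseP (last_letter_ex (card_ge2 pi) (pi_bP pi))). Qed.

Lemma letters_gt0 (pi : comb_data A) : (0 < #|A|)%N.
Proof. exact: ltn_trans (card_ge2 pi). Qed.

Context (T : iem R A) (Tpos : pos_len T).
Let ptP := pi_tP (data T).
Let pbP := pi_bP (data T).

Lemma Iv_cover x : domain T x -> exists a, Iv T a x.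
Proof. by move=> xD; apply: cum_cover => //; exact: letters_gt0 (data T). Qed.

Lemma Iv_uniq a b x : Iv T a x -> Iv T b x -> a = b.
Proof. exact: cum_uniq. Qed.

Lemma Iv_domain a x : Iv T a x -> domain T x.
Proof.
move=> /andP[ax xa]; apply/andP; split.
  exact: le_trans (cum_ge0 _ a Tpos) ax.
exact: lt_le_trans xa (cum_le_total _ ptP Tpos).
Qed.

Lemma iet_mapE a x : Iv T a x -> iet_map T x = x - p_ T a + q_ T a.
Proof.
move=> ax; rewrite /iet_map; case: pickP => [b bx|/(_ a)]; last by rewrite [_ && _]ax.
by rewrite (Iv_uniq ax bx).
Qed.

Lemma iet_map_out x : ~ domain T x -> iet_map T x = x.
Proof.
move=> xD; rewrite /iet_map; case: pickP => // a ax.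
by case: xD; exact: Iv_domain ax.
Qed.

Lemma iet_map_domain x : domain T x -> domain T (iet_map T x).
Proof.
move=> /Iv_cover[a /[dup] aI /andP[a1 a2]]; rewrite (iet_mapE aI).
have q0 : 0 <= q_ T a by exact: cum_ge0.
have qL : q_ T a + len T a <= total_len T by exact: cum_le_total.
by apply/andP; split; lra.
Qed.

Lemma iet_map_domainE x : domain T (iet_map T x) <-> domain T x.
Proof.
split; last exact: iet_map_domain.
by have [//|xD] := pselect (domain T x); rewrite iet_map_out.
Qed.

(** The images of the top intervals are the bottom intervals, which are disjoint; outside the domain
    the map is the identity. *)
Lemma iet_map_inj : injective (iet_map T).
Proof.
move=> x y xy; have [xD|xD] := pselect (domain T x); last first.
  have yD : ~ domain T y by rewrite -iet_map_domainE -xy iet_map_domainE.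
  by rewrite -(iet_map_out xD) -(iet_map_out yD).
have yD : domain T y by rewrite -iet_map_domainE -xy iet_map_domainE.
have [a aI] := Iv_cover xD; have [b bI] := Iv_cover yD.
have Ex := iet_mapE aI; have Ey := iet_mapE bI.
suff ab : a = b by move: xy; rewrite Ex Ey ab; lra.
apply: (cum_uniq (x := iet_map T x) pbP Tpos).
  by move: aI => /andP[]; rewrite /q_ -/(cum _ _ _) in Ex *; rewrite Ex; lra.
by move: bI => /andP[]; rewrite /q_ -/(cum _ _ _) in Ey *; rewrite xy Ey; lra.
Qed.

Lemma iter_inj n : injective (iter n (iet_map T)).
Proof. by elim: n => //= n IH x y /iet_map_inj /IH. Qed.

Lemma iter_domain n x : domain T (iter n (iet_map T) x) <-> domain T x.
Proof. by elim: n => //= n; rewrite iet_map_domainE. Qed.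

Lemma domain_p a : domain T (p_ T a).
Proof. by apply: (@Iv_domain a); rewrite /Iv lexx ltrDl /=. Qed.

Lemma total_gt0 : 0 < total_len T.
Proof. by have /andP[] := domain_p (alpha_t (data T)); exact: le_lt_trans. Qed.

End IET.

(** * Towers over the induced maps *)

Section Step.
Context {R : realType} {A : finType}.
Implicit Types (T : iem R A).

Definition win T := if top_type T then alpha_t (data T) else alpha_b (data T).
Definition los T := if top_type T then alpha_b (data T) else alpha_t (data T).

Lemma len_induction T b :
  len (induction T) b = if b == win T then len T (win T) - len T (los T) else len T b.
Proof. by rewrite /induction /win /los; case: ifP. Qed.

Lemma total_len_induction T : total_len (induction T) = total_len T - len T (los T).
Proof.
rewrite /total_len (bigD1 (win T)) //= [in RHS](bigD1 (win T)) //= len_induction eqxx.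
rewrite addrAC; congr (_ + _ + _); apply: eq_bigr => b bw.
by rewrite len_induction (negbTE bw).
Qed.

Lemma p_induction_top T b : top_type T -> p_ (induction T) b = p_ T b.
Proof.
move=> tT; rewrite /p_ /induction tT /=.
exact: (cum_last_change _ _ _ (pi_tP (data T)) (alpha_tP _)).
Qed.

Lemma q_induction_bot T b : top_type T = false -> q_ (induction T) b = q_ T b.
Proof.
move=> tT; rewrite /q_ /induction tT /=.
exact: (cum_last_change _ _ _ (pi_bP (data T)) (alpha_bP _)).
Qed.

Lemma q_induction_top T b : top_type T -> win T <> los T ->
  q_ (induction T) b =
  if b == los T then q_ T (win T) + len T (win T) - len T (los T) else q_ T b.
Proof.
rewrite /win /los => tT; rewrite tT => wl; rewrite /q_ /induction tT /=.
exact: (cum_move_last _ _ (pi_bP (data T)) (alpha_bP _)).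
Qed.

Lemma p_induction_bot T b : top_type T = false -> win T <> los T ->
  p_ (induction T) b =
  if b == los T then p_ T (win T) + len T (win T) - len T (los T) else p_ T b.
Proof.
rewrite /win /los => tT; rewrite tT => wl; rewrite /p_ /induction tT /=.
exact: (cum_move_last _ _ (pi_tP (data T)) (alpha_tP _)).
Qed.

Lemma p_alpha_t T : p_ T (alpha_t (data T)) = total_len T - len T (alpha_t (data T)).
Proof. by apply/eqP; rewrite -subr_eq opprK; apply/eqP/(cum_total _ (pi_tP _) (alpha_tP _)). Qed.

Lemma q_alpha_b T : q_ T (alpha_b (data T)) = total_len T - len T (alpha_b (data T)).
Proof. by apply/eqP; rewrite -subr_eq opprK; apply/eqP/(cum_total _ (pi_bP _) (alpha_bP _)). Qed.

Lemma data_induction T :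
  data (induction T) = if top_type T then Rauzy_t (data T) else Rauzy_b (data T).
Proof. by rewrite /induction; case: ifP. Qed.

Lemma pi_t_first T b : (1 < pi_t (data (induction T)) b)%N = (1 < pi_t (data T) b)%N.
Proof.
rewrite data_induction //; case: ifP => // _ /=; rewrite /move_last.
have := numbering_ge1 (alpha_b (data T)) (pi_tP (data T)).
by have := card_ge2 (data T); do !case: ifP; lia.
Qed.

End Step.

Section Towers.
Context {R : realType} {A : finType} (T : iem R A).
Implicit Types (a b c : A) (n k : nat).

Notation f := (iet_map T).
Notation "T_[ n ]" := (iem_at T n) (at level 0, format "T_[ n ]").

Definition wi n := win T_[n].
Definition lo n := los T_[n].
Definition top n := top_type T_[n].

(** The new interval of the loser climbs the towers of both the loser and the winner before it
    returns, hence the sum. *)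
Fixpoint ret n b : nat := if n is m.+1 then
  (if b == lo m then ret m b + ret m (wi m) else ret m b)%N else 1%N.

(* [f ^ (hgt n b)] maps the left endpoint of the interval of [b] at step [n]
   to its left endpoint at step 0. *)
Fixpoint hgt n b : nat := if n is m.+1 then
  (if ~~ top m && (b == lo m) then ret m (wi m) + hgt m b else hgt m b)%N else 0%N.

Definition translates k (x y l : R) : Prop :=
  forall u, 0 <= u < l -> iter k f (x + u) = y + u.

Lemma translates_comp k k' x y z l l' : l <= l' ->
  translates k x y l -> translates k' y z l' -> translates (k' + k) x z l.
Proof.
move=> ll' H H' u /andP[u0 ul]; rewrite iterD H ?u0// H' // u0 /=.
exact: lt_le_trans ul ll'.
Qed.

Lemma translates_sub k x y l v x' y' l' : 0 <= v -> x' = x + v -> y' = y + v -> v + l' <= l ->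
  translates k x y l -> translates k x' y' l'.
Proof.
move=> v0 -> -> vl H u /andP[u0 ul]; rewrite -!addrA H //.
by apply/andP; split; lra.
Qed.

(** [tw_ret] and [tw_return] make the induced map a first return map. [tw_hgt] and [tw_hgt_lt] put
    [p_ T b] on the tower over [b], which links its left endpoint at step [n] to that at step 0. *)
Record towers n : Prop := Towers {
  tw_pos : pos_len T_[n];
  tw_dom : forall x, domain T_[n] x -> domain T x;
  tw_first : forall b, (1 < pi_t (data T_[n]) b)%N = (1 < pi_t (data T) b)%N;
  tw_ret : forall b, translates (ret n b) (p_ T_[n] b) (q_ T_[n] b) (len T_[n] b);
  tw_hgt : forall b, translates (hgt n b) (p_ T_[n] b) (p_ T b) (len T_[n] b);
  tw_hgt_lt : forall b, (hgt n b < ret n b)%N;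
  tw_return : forall b x i, Iv T_[n] b x -> (0 < i < ret n b)%N ->
    ~ domain T_[n] (iter i f x) }.

Arguments tw_ret {n} _ b.
Arguments tw_hgt {n} _ b.
Arguments tw_hgt_lt {n} _ b.

Hypotheses (Tpos : pos_len T) (TK : Keane T).

Lemma translates0 n b k y : towers n -> translates k (p_ T_[n] b) y (len T_[n] b) ->
  iter k f (p_ T_[n] b) = y.
Proof.
by move=> tw /(_ 0); rewrite !addr0 lexx => -> //; exact: (tw_pos tw).
Qed.

(* A connection at step [n] would be one for [T]. *)
Lemma no_connection n a b : towers n -> (1 < pi_t (data T_[n]) b)%N ->
  p_ T_[n] b <> q_ T_[n] a.
Proof.
move=> tw b1 E; apply: TK; exists a, b, (hgt n b + (ret n a - hgt n a))%N.
have := tw_hgt_lt tw a => ha; split; [lia| |by rewrite -(tw_first tw)].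
rewrite -(translates0 tw (tw_hgt tw b)) iterD; congr (iter _ f _).
rewrite E -(translates0 tw (tw_ret tw a)) -(translates0 tw (tw_hgt tw a)).
by rewrite -iterD subnK // ltnW.
Qed.

Lemma alpha_t_nonfirst (pi : comb_data A) : (1 < pi_t pi (alpha_t pi))%N.
Proof. by rewrite alpha_tP; exact: card_ge2. Qed.

Lemma wi_neq_lo n : towers n -> wi n <> lo n.
Proof.
move=> tw E; have {}E : alpha_t (data T_[n]) = alpha_b (data T_[n]).
  by move: E; rewrite /wi /lo /win /los; case: ifP.
have := @no_connection n (alpha_b (data T_[n])) _ tw (alpha_t_nonfirst _).
by rewrite p_alpha_t q_alpha_b E.
Qed.

(** If the two last letters had equal lengths, [p_] of one and [q_] of the other would coincide, a
    connection. *)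
Lemma len_lo_lt n : towers n -> len T_[n] (lo n) < len T_[n] (wi n).
Proof.
move=> tw; have ne : len T_[n] (alpha_t (data T_[n])) != len T_[n] (alpha_b (data T_[n])).
  apply/eqP => E; have := @no_connection n (alpha_b (data T_[n])) _ tw (alpha_t_nonfirst _).
  by rewrite p_alpha_t q_alpha_b E.
rewrite /wi /lo /win /los; case: ifP => [|/negbT]; rewrite /top_type ?lt_neqAle.
  by move=> ->; rewrite eq_sym ne.
by rewrite -ltNge lt_neqAle => /andP[-> ->].
Qed.

Lemma towers0 : towers 0.
Proof.
split => //=.
- move=> b u /andP[u0 ul] /=; rewrite (@iet_mapE _ _ _ Tpos b); first by lra.
  by rewrite /Iv; lra.
- by move=> b x i _ ?; exfalso; lia.
Qed.

Lemma domain_wi_lo n u : towers n -> 0 <= u < len T_[n] (lo n) ->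
  ~ domain T_[n.+1] (total_len T_[n] - len T_[n] (lo n) + u).
Proof.
move=> tw /andP[u0 ul]; rewrite /domain /= total_len_induction -/(lo n).
by move=> /andP[_]; lra.
Qed.

(** The segment removed by the step starts at [y]. The new interval of the loser lies in the old
    interval of one of the two letters, returns first to the removed segment, which lies in the old
    interval of the other letter, and only then to the new domain. The type of the step decides
    which letter comes first. *)
Lemma tower_step_lo n : towers n ->
  let y := total_len T_[n] - len T_[n] (lo n) in
  [/\ translates (ret n (if top n then lo n else wi n)) (p_ T_[n.+1] (lo n)) y (len T_[n] (lo n)),
      translates (ret n (if top n then wi n else lo n)) y (q_ T_[n.+1] (lo n)) (len T_[n] (lo n)),
      forall u, 0 <= u < len T_[n] (lo n) ->
        Iv T_[n] (if top n then lo n else wi n) (p_ T_[n.+1] (lo n) + u) &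
      forall u, 0 <= u < len T_[n] (lo n) ->
        Iv T_[n] (if top n then wi n else lo n) (y + u)].
Proof.
move=> tw y; have wl := wi_neq_lo tw; have ll := len_lo_lt tw; have pos := tw_pos tw.
have l0 := pos (lo n).
case: (boolP (top n)) => [tn|/negbTE tn].
  have lE : lo n = alpha_b (data T_[n]) by rewrite /lo /los [top_type _]tn.
  have wE : wi n = alpha_t (data T_[n]) by rewrite /wi /win [top_type _]tn.
  have pw := p_alpha_t T_[n]; have qb := q_alpha_b T_[n]; rewrite -lE -wE in pw qb.
  rewrite /= p_induction_top // q_induction_top // -/(wi n) -/(lo n) eqxx.
  split => //.
  - by have := tw_ret tw (lo n); rewrite qb.
  - apply: (translates_sub (v := len T_[n] (wi n) - len T_[n] (lo n)) _ _ _ _ (tw_ret tw (wi n))).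
    + by rewrite subr_ge0 ltW.
    + by rewrite /y pw; lra.
    + by rewrite addrA.
    + by lra.
  - by move=> u /andP[u0 ul]; rewrite /Iv; lra.
  - by move=> u /andP[u0 ul]; rewrite /Iv /y pw; lra.
have lE : lo n = alpha_t (data T_[n]) by rewrite /lo /los [top_type _]tn.
have wE : wi n = alpha_b (data T_[n]) by rewrite /wi /win [top_type _]tn.
have pw := p_alpha_t T_[n]; have qb := q_alpha_b T_[n]; rewrite -lE -wE in pw qb.
rewrite /= p_induction_bot // q_induction_bot // -/(wi n) -/(lo n) eqxx.
split => //.
- apply: (translates_sub (v := len T_[n] (wi n) - len T_[n] (lo n)) _ _ _ _ (tw_ret tw (wi n))).
  + by rewrite subr_ge0 ltW.
  + by rewrite addrA.
  + by rewrite /y qb; lra.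
  + by lra.
- by have := tw_ret tw (lo n); rewrite pw.
- by move=> u /andP[u0 ul]; rewrite /Iv; lra.
- by move=> u /andP[u0 ul]; rewrite /Iv /y pw; lra.
Qed.

Lemma p_next n b : towers n -> b != lo n -> p_ T_[n.+1] b = p_ T_[n] b.
Proof.
move=> tw bl; case: (boolP (top n)) => [tn|/negbTE tn]; rewrite /=.
  by rewrite p_induction_top.
by rewrite p_induction_bot ?(negbTE bl)//; exact: wi_neq_lo.
Qed.

Lemma q_next n b : towers n -> b != lo n -> q_ T_[n.+1] b = q_ T_[n] b.
Proof.
move=> tw bl; case: (boolP (top n)) => [tn|/negbTE tn]; rewrite /=.
  by rewrite q_induction_top ?(negbTE bl)//; exact: wi_neq_lo.
by rewrite q_induction_bot.
Qed.

Lemma len_next n b : len T_[n.+1] b =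
  if b == wi n then len T_[n] (wi n) - len T_[n] (lo n) else len T_[n] b.
Proof. exact: len_induction. Qed.

Lemma total_next n : total_len T_[n.+1] = total_len T_[n] - len T_[n] (lo n).
Proof. exact: total_len_induction. Qed.

Lemma len_next_le n b : towers n -> len T_[n.+1] b <= len T_[n] b.
Proof.
by move=> tw; rewrite len_next; case: eqP => // ->; rewrite gerBl ltW// (tw_pos tw).
Qed.

Lemma domain_next n x : towers n -> domain T_[n.+1] x -> domain T_[n] x.
Proof.
move=> tw; rewrite /domain /= total_len_induction => /andP[-> /lt_le_trans]; apply.
by rewrite gerBl ltW// (tw_pos tw).
Qed.

Lemma towersS n : towers n -> towers n.+1.
Proof.
move=> tw; have wl := wi_neq_lo tw; have pos := tw_pos tw.
have lenl : len T_[n.+1] (lo n) = len T_[n] (lo n).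
  by rewrite len_next ifN//; apply/eqP => lw; apply: wl.
have [H1 H2 H3 H4] := tower_step_lo tw.
split.
- move=> b; rewrite len_next; case: ifP => // _.
  by rewrite subr_gt0; exact: len_lo_lt.
- by move=> x /(domain_next tw); exact: tw_dom.
- by move=> b; rewrite -(tw_first tw) /= pi_t_first.
- move=> b; have [->|bl] := eqVneq b (lo n).
    rewrite lenl /= eqxx; have := translates_comp (lexx _) H1 H2.
    by case: (top n); rewrite // addnC.
  rewrite /= (negbTE bl) p_next// q_next//.
  apply: (translates_sub (v := 0) _ _ _ _ (tw_ret tw b)); rewrite ?addr0 ?add0r//.
  exact: len_next_le.
- move=> b; have [->|bl] := eqVneq b (lo n); last first.
    rewrite /= (negbTE bl) andbF p_next//.
    apply: (translates_sub (v := 0) _ _ _ _ (tw_hgt tw b)); rewrite ?addr0 ?add0r//.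
    exact: len_next_le.
  rewrite lenl /= eqxx andbT; case: (boolP (top n)) H1 H2 => tn /= H1 H2.
    by rewrite p_induction_top//; exact: tw_hgt.
  rewrite addnC; apply: (translates_comp (lexx _) H1).
  have E : lo n = alpha_t (data T_[n]) by rewrite /lo /los ifN.
  have -> : total_len T_[n] - len T_[n] (lo n) = p_ T_[n] (lo n).
    by rewrite E p_alpha_t.
  exact: tw_hgt.
- move=> b /=; have := tw_hgt_lt tw b.
  by case: (b == lo n); rewrite ?andbF ?andbT //; case: (top n) => /=; lia.
- move=> b x i xb.
  have [bE|bl] := eqVneq b (lo n); last first.
    rewrite /= (negbTE bl) => ib /(domain_next tw); apply: tw_return ib => //.
    move: xb => /andP[]; rewrite /Iv p_next// => -> /= /lt_le_trans; apply.
    by rewrite lerD2l; exact: len_next_le.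
  rewrite bE in xb *; have [u u0 xE] : exists2 u, 0 <= u < len T_[n] (lo n) & x = p_ T_[n.+1] (lo n) + u.
    exists (x - p_ T_[n.+1] (lo n)); last by rewrite addrC subrK.
    by move: xb; rewrite /Iv lenl => /andP[]; lra.
  rewrite xE /= eqxx => /andP[i0 ir].
  set c := if top n then lo n else wi n in H1 H3.
  set d := if top n then wi n else lo n in H2 H4.
  have rE : (ret n (lo n) + ret n (wi n) = ret n c + ret n d)%N.
    by rewrite /c /d; case: (top n); rewrite // addnC.
  have [ic|] := ltnP i (ret n c).
    by move=> /(domain_next tw); apply: (@tw_return _ tw c); [exact: H3|rewrite i0].
  (* At time [ret n c] the orbit is in the removed segment; at the other times it is strictly inside
     an old tower. *)
  rewrite leq_eqVlt => /orP[/eqP ci|ci].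
    by rewrite -ci H1//; exact: domain_wi_lo.
  have -> : i = (i - ret n c + ret n c)%N by lia.
  rewrite iterD H1// => /(domain_next tw); apply: (@tw_return _ tw d); first exact: H4.
  by lia.
Qed.

Lemma towersP n : towers n.
Proof. by elim: n => [|n /towersS//]; exact: towers0. Qed.
End Towers.

Arguments tw_ret {R A T n} _ b.
Arguments tw_hgt {R A T n} _ b.
Arguments tw_hgt_lt {R A T n} _ b.

(** * Winning letters *)

Section Eventually.

Lemma eventually_all (A : finType) (Q : A -> nat -> Prop) :
  (forall b, exists n, forall i, (n <= i)%N -> Q b i) ->
  exists n, forall i, (n <= i)%N -> forall b, Q b i.
Proof.
move=> /choice[n_ nP]; exists (\max_b n_ b) => i ni b; apply: nP.
exact: leq_trans (leq_bigmax b) ni.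
Qed.

Lemma eventually_constant (u : nat -> nat) n0 M :
  (forall i, (n0 <= i)%N -> (u i <= u i.+1 <= M)%N) ->
  exists n, forall i, (n <= i)%N -> u i.+1 = u i.
Proof.
move=> uM; apply: contrapT => H.
have {}H n : exists2 i, (n <= i)%N & u i.+1 <> u i.
  apply: contrapT => H'; apply: H; exists n => i ni.
  by apply: contrapT => uu; apply: H'; exists i.
have mono k i : (n0 <= i)%N -> (u i <= u (i + k))%N.
  move=> ni; elim: k => [|k]; first by rewrite addn0.
  by move=> /leq_trans; apply; rewrite addnS; have := uM (i + k)%N; lia.
have /(_ M.+1)[i ni] : forall k, exists2 i, (n0 <= i)%N & (k <= u i)%N.
  elim=> [|k [i ni ki]]; first by exists n0.
  have [j ij uj] := H i; exists j.+1; first by lia.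
  by have := uM j; have := mono (j - i)%N _ ni; rewrite subnKC//; lia.
by have := uM i ni; lia.
Qed.

Lemma no_infinite_drop (R : realType) (u : nat -> R) e : 0 < e ->
  (forall i, 0 <= u i) -> (forall i, u i.+1 <= u i) ->
  ~ forall n, exists2 i, (n <= i)%N & u i.+1 <= u i - e.
Proof.
move=> e0 u0 uS H.
have mono k i : u (i + k)%N <= u i.
  by elim: k => [|k]; rewrite ?addn0// addnS; exact: le_trans.
have [k kP] : exists k : nat, u 0%N < k%:R * e.
  exists (Num.truncn (u 0%N / e)).+1.
  by rewrite -ltr_pdivrMr//; exact: truncnS_gt.
have [i] : exists i, u i <= u 0%N - k%:R * e.
  elim: k {kP} => [|k [i IH]]; first by exists 0%N; rewrite mul0r subr0.
  have [j ij uj] := H i; exists j.+1; rewrite -natr1 mulrDl mul1r.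
  by have := mono (j - i)%N i; rewrite subnKC//; lra.
by have := u0 i; lra.
Qed.

End Eventually.

(** * Properties that spread from winners to losers *)

Section Blocks.
Context {A : finType} (w l : nat -> A).
Hypothesis wS : forall n, w n = w n.+1 \/ w n = l n.+1.

Definition win_all s e := forall a, exists2 i, (s <= i < e)%N & w i = a.

(** Used for a large return time, a small length, and a tower that visits a given interval. *)
Definition spreading (P : nat -> A -> Prop) := forall n,
  (forall b, P n b -> P n.+1 b) /\ (P n (w n) -> P n.+1 (l n)).

Lemma spreading_mono P s : spreading P -> forall e b, (s <= e)%N -> P s b -> P e b.
Proof.
move=> Pcl; elim=> [|e IH] b; first by rewrite leqn0 => /eqP ->.
by rewrite leq_eqVlt => /orP[/eqP ->//|se] /(IH _ se) /(proj1 (Pcl e)).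
Qed.

(* If P does not grow, its complement cannot lose to P, so that the winners can
   leave P but never come back to it. *)
Lemma spreading_grow P s e1 e2 a b0 : spreading P ->
  win_all s e1 -> win_all e1 e2 -> P s a -> ~ P s b0 ->
  exists2 b, ~ P s b & P e2 b.
Proof.
move=> Pcl w1 w2 Pa nPb; apply: contrapT => H.
have Pe b i : (s <= i <= e2)%N -> P i b -> P s b.
  move=> si Pib; apply: contrapT => nPs; apply: H; exists b => //.
  by apply: (spreading_mono Pcl _ Pib); lia.
have [i0 i0P wi0] := w1 b0; have [j0 j0P wj0] := w2 a.
(* From time [i0], at which [b0] wins, up to [j0], no winner satisfies [P s]: a first one that did
   would pass [P] to the previous winner, then the loser. *)
suff : ~ P s (w j0) by rewrite wj0.
have : (i0 <= j0)%N by lia.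
have : (j0 < e2)%N by lia.
elim: j0 {j0P wj0} => [|j IH] je ij; first by move: ij; rewrite leqn0 => /eqP <-; rewrite wi0.
have [->|ij'] := eqVneq j.+1 i0; first by rewrite wi0.
have {}IH : ~ P s (w j) by apply: IH; lia.
have [<-//|wl] := wS j; move=> Pw; apply: IH; rewrite wl.
apply: (@Pe _ j.+2); first by lia.
apply: (proj2 (Pcl j.+1)).
by apply: (spreading_mono Pcl _ Pw); lia.
Qed.

(** Two consecutive stretches add at least one letter to the set of letters with [P], unless it is
    already full. *)
Lemma spreading_all P (t : nat -> nat) a : spreading P ->
  (forall j, win_all (t j) (t j.+1)) -> P (t 0%N) a ->
  forall b, P (t (2 * #|A|)%N) b.
Proof.
move=> Pcl tw Pa.
have tS j : (t j <= t j.+1)%N by have [i] := tw j a; lia.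
have tmono i j : (i <= j)%N -> (t i <= t j)%N.
  elim: j => [|j IH]; first by rewrite leqn0 => /eqP ->.
  by rewrite leq_eqVlt => /orP[/eqP ->//|/IH /leq_trans]; apply.
pose S j := [set b | `[<P (t (2 * j)%N) b>]]%SET.
have inS j b : (b \in S j) <-> P (t (2 * j)%N) b.
  by rewrite inE; split=> [/asboolP|/asboolP].
have SS j : (S j != [set: A]%SET -> (#|S j| < #|S j.+1|)%N).
  move=> /eqP ST; apply: proper_card; rewrite properE; apply/andP; split.
    apply/fintype.subsetP => b /inS Pb; apply/inS.
    by apply: (spreading_mono Pcl _ Pb); apply: tmono; lia.
  have [b0 nPb0] : exists b0, ~ P (t (2 * j)%N) b0.
    apply: contrapT => H; apply: ST; apply/setP => b; rewrite finset.in_setT.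
    by apply/inS; apply: contrapT => nb; apply: H; exists b.
  have Paj : P (t (2 * j)%N) a by apply: (spreading_mono Pcl _ Pa); exact: tmono.
  have := spreading_grow Pcl (tw (2 * j)%N) (tw _) Paj nPb0.
  have -> : ((2 * j).+2 = 2 * j.+1)%N by lia.
  by move=> [b nPb Pb]; apply/fintype.subsetPn; exists b; [apply/inS|apply/negP => /inS].
have H j : (minn j #|A| <= #|S j|)%N.
  elim: j => [|j IH]; first by rewrite min0n.
  have [E|/SS] := eqVneq (S j) [set: A]%SET; last by move: IH; lia.
  suff -> : S j.+1 = [set: A]%SET by rewrite finset.cardsT geq_minr.
  apply/setP => b; rewrite finset.in_setT; apply/inS.
  have /inS Pb : b \in S j by rewrite E finset.in_setT.
  by apply: (spreading_mono Pcl _ Pb); apply: tmono; lia.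
have := H #|A|; rewrite minnn => SA b.
have /eqP SE : S #|A| == [set: A]%SET by rewrite eqEcard finset.subsetT finset.cardsT.
by apply/inS; rewrite SE finset.in_setT.
Qed.

End Blocks.

(** * Rows of the combinatorial data; every letter wins infinitely often *)

Section Rows.
Context {R : realType} {A : finType} (T : iem R A).
Implicit Types (a b c : A) (n k : nat) (t : bool).
Notation "T_[ n ]" := (iem_at T n) (at level 0, format "T_[ n ]").
Notation wi := (wi T). Notation lo := (lo T). Notation top := (top T).

(** Indexing the rows by a boolean treats both types at once: step [n] keeps the row [top n] and
    changes the other one. *)
Definition rowpos t n : A -> nat :=
  if t then pi_t (data T_[n]) else pi_b (data T_[n]).

Lemma rowposP t n : is_numbering (rowpos t n).
Proof. by case: t; [exact: pi_tP|exact: pi_bP]. Qed.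

Lemma rowpos_inj t n : injective (rowpos t n).
Proof. by have [] := rowposP t n. Qed.

Lemma rowpos_next t n b : rowpos t n.+1 b =
  if top n == t then rowpos t n b else move_last (rowpos t n (wi n)) (rowpos t n) b.
Proof.
by rewrite /rowpos /= data_induction /wi /win -/(top n); case: t; case: (top n).
Qed.

Lemma rowpos_last t n : rowpos t n (if top n == t then wi n else lo n) = #|A|.
Proof.
rewrite /rowpos /wi /lo /win /los -/(top n).
by case: t; case: (top n); rewrite /= ?alpha_tP ?alpha_bP.
Qed.

(** The winner stays last in its row, so it takes part in the next step. *)
Lemma wi_next n : wi n = wi n.+1 \/ wi n = lo n.+1.
Proof.
have := rowpos_last (top n) n; rewrite eqxx => H.
have {}H : rowpos (top n) n.+1 (wi n) = #|A| by rewrite rowpos_next eqxx.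
have := rowpos_last (top n) n.+1; rewrite -H => /rowpos_inj <-.
by case: ifP; [left|right].
Qed.

Hypotheses (Tpos : pos_len T) (TK : Keane T).
Let tw n := towersP Tpos TK n.

Lemma total_decr n : total_len T_[n.+1] <= total_len T_[n].
Proof. by rewrite total_next gerBl ltW// (tw_pos (tw n)). Qed.

Lemma total_pos n : 0 < total_len T_[n].
Proof. exact: total_gt0 (tw_pos (tw n)). Qed.

(** A letter that no longer wins keeps its length, and each of its losses shortens the domain by
    this fixed amount. *)
Lemma loses_rarely b : (exists n, forall i, (n <= i)%N -> wi i <> b) ->
  exists n, forall i, (n <= i)%N -> lo i <> b.
Proof.
move=> [n nP]; apply: contrapT => H.
have lenb i : (n <= i)%N -> len T_[i] b = len T_[n] b.
  move=> ni; rewrite -(subnKC ni); elim: (i - n)%N => [|k IH]; first by rewrite addn0.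
  rewrite addnS len_next ifN//; apply/eqP => E.
  by apply: (nP (n + k)%N); rewrite ?leq_addr.
apply: (@no_infinite_drop _ (fun i => total_len T_[i]) (len T_[n] b)).
- exact: tw_pos (tw n) b.
- by move=> i; exact: ltW (total_pos i).
- exact: total_decr.
move=> m; apply: contrapT => H'; apply: H; exists (maxn n m) => i.
rewrite geq_max => /andP[ni mi] lb; apply: H'; exists i => //.
by rewrite total_next lb lenb.
Qed.

Definition rare b := exists n, forall i, (n <= i)%N -> wi i <> b.

(** Once a letter neither wins nor loses, its positions can only increase; being bounded, they
    stabilise. *)
Lemma rare_frozen : exists n, forall i, (n <= i)%N -> forall b, rare b ->
  [/\ wi i <> b, lo i <> b & forall t, rowpos t i.+1 b = rowpos t i b].
Proof.
apply: eventually_all => b; have [rb|] := pselect (rare b); last by exists 0%N.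
have [n1 P1] := rb; have [n2 P2] := loses_rarely rb.
have ev t : exists n, forall i, (n <= i)%N -> rowpos t i.+1 b = rowpos t i b.
  apply: (@eventually_constant _ (maxn n1 n2) #|A|) => i; rewrite geq_max => /andP[i1 i2].
  rewrite (numbering_le _ (rowposP t i.+1)) andbT rowpos_next; case: ifP => // tt.
  have := rowpos_last t i; rewrite tt => tl.
  rewrite /move_last; case: ifP => // _; case: ifP => // /negbT.
  have := numbering_le b (rowposP t i); rewrite leq_eqVlt => /orP[|->//].
  by rewrite -tl => /eqP /rowpos_inj /esym /(P2 _ i2).
have [m1 Q1] := ev true; have [m2 Q2] := ev false.
exists (maxn (maxn n1 n2) (maxn m1 m2)) => i; rewrite !geq_max.
move=> /andP[/andP[i1 i2] /andP[j1 j2]] _; split; [exact: P1|exact: P2|].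
by case; [exact: Q1|exact: Q2].
Qed.

(** When its row changes, a frozen [b] cannot be to the right of the winner, or it would be pushed.
    So a letter [c] before [b] stays before it, and [c] cannot win: a winner is last in the row or
    not to the left of [b], which would force [c = b]. *)
Lemma rare_downclosed : exists n, forall t b c, rare b ->
  (rowpos t n c <= rowpos t n b)%N -> rare c.
Proof.
have [n nP] := rare_frozen; exists n => t b c rb cb.
have step i : (n <= i)%N -> (rowpos t i c <= rowpos t i b)%N ->
    wi i <> c /\ (rowpos t i.+1 c <= rowpos t i.+1 b)%N.
  move=> ni ci; have [wb lb rowb] := nP i ni b rb; rewrite rowb rowpos_next.
  have := rowpos_last t i; have := rowb t; rewrite rowpos_next; case: ifP => tt.
    move=> _ tl; split=> // wc; apply: wb; apply: (@rowpos_inj t i); rewrite tl.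
    by apply/eqP; rewrite eqn_leq (numbering_le _ (rowposP t i)) andbT -tl wc.
  have bA : (rowpos t i b < #|A|)%N -> True by [].
  move=> + tl; have {}bA : (rowpos t i b < #|A|)%N.
    have := numbering_le b (rowposP t i); rewrite leq_eqVlt => /orP[|//].
    by rewrite -tl => /eqP /rowpos_inj /esym /lb.
  rewrite /move_last bA; case: ifP => [bw _|_]; last by lia.
  rewrite (leq_trans ci bw); split=> // wc; apply: wb.
  by apply: (@rowpos_inj t i); rewrite wc in bw *; lia.
exists n => i ni; suff : (rowpos t i c <= rowpos t i b)%N by move=> /(step _ ni)[].
rewrite -(subnKC ni); elim: (i - n)%N => [|k IH]; first by rewrite addn0.
by rewrite addnS; apply: (proj2 (step _ _ IH)); rewrite leq_addr.
Qed.

(* Otherwise the letters that win finitely often would eventually fill the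
   beginning of both rows. *)
Lemma wins_often b n : exists2 i, (n <= i)%N & wi i = b.
Proof.
apply: contrapT => H; have rb : rare b.
  by exists n => i ni wb; apply: H; exists i.
have [m mP] := rare_downclosed.
have [a0 nra0] : exists a, ~ rare a.
  apply: contrapT => H'.
  have [i iP] : exists i, forall j, (i <= j)%N -> forall a, wi j <> a.
    apply: eventually_all => a; apply: contrapT => nra; apply: H'; exists a => -[k kP].
    by apply: nra; exists k.
  exact: (iP i (leqnn _) (wi i)).
have side t : exists a, ~ rare a /\ forall c, (rowpos t m c < rowpos t m a)%N <-> rare c.
  pose Q a := ~~ `[<rare a>].
  have Q0 : Q a0 by apply/asboolPn.
  case: (@arg_minnP _ a0 Q (rowpos t m) Q0) => a /asboolPn na amin.
  exists a; split=> // c; split=> [|rc].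
    move=> ca; apply: contrapT => /asboolPn /amin; lia.
  by rewrite ltnNge; apply/negP => /(mP _ _ _ rc).
have [a1 [n1 P1]] := side true; have [a2 [n2 P2]] := side false.
(* The rare letters are exactly those before [a1] on top and those before [a2] at the bottom, so
   [p_] of [a1] and [q_] of [a2] are the same sum. *)
apply: (@no_connection _ _ T TK m a2 a1 (tw m)).
  have := numbering_ge1 b (rowposP true m); have := (P1 b).2 rb.
  by rewrite /rowpos; lia.
apply: eq_bigl => c; apply/idP/idP => [/(P1 c).1/(P2 c).2//|/(P2 c).1/(P1 c).2//].
Qed.

Lemma win_all_ex s : exists2 e, (s < e)%N & win_all wi s e.
Proof.
have /choice[i_ iP] b : exists i, (s <= i)%N /\ wi i = b.
  by have [i si wb] := wins_often b s; exists i.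
exists (s + \max_b i_ b).+1; first by lia.
by move=> b; exists (i_ b); have [? ?] := iP b; rewrite // ltnS; have := @leq_bigmax _ i_ b; lia.
Qed.

Lemma spreading_total P s a : spreading wi lo P -> P s a ->
  exists2 e, (s <= e)%N & forall b, P e b.
Proof.
move=> Pcl Pa; have /choice[e_ eP] n : exists e, (n < e)%N /\ win_all wi n e.
  by have [e ? ?] := win_all_ex n; exists e.
pose u j := iter j e_ s.
exists (u (2 * #|A|)%N).
  by elim: (2 * _)%N => //= j IH; have [] := eP (u j); rewrite /u in IH *; lia.
by apply: (spreading_all wi_next Pcl (t := u) (a := a)) => // j; have [] := eP (u j).
Qed.

End Rows.

(** * Matrices and lengths *)

Section Matrices.
Context {R : realType} {A : finType} (T : iem R A).
Implicit Types (a b c : A) (n k : nat).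
Notation "T_[ n ]" := (iem_at T n) (at level 0, format "T_[ n ]").
Notation wi := (wi T). Notation lo := (lo T). Notation top := (top T).
Notation ret := (ret T).

Definition Bentry n n' b a : R := B T n n' (enum_rank b) (enum_rank a).

Lemma Bentry_id n b a : Bentry n n b a = (b == a)%:R.
Proof.
rewrite /Bentry /B /gamma /index_iota subnn /= /path_mx /= mxE.
by rewrite (inj_eq enum_rank_inj).
Qed.

Lemma Bentry_next n n' b a : (n <= n')%N ->
  Bentry n n'.+1 b a = Bentry n n' b a + (b == lo n')%:R * Bentry n n' (wi n') a.
Proof.
move=> nn; rewrite /Bentry /B /gamma /index_iota subSn// -addn1 iotaD map_cat.
rewrite subnKC// /path_mx foldl_cat /= mulmxDl mul1mx mxE; congr (_ + _).
rewrite mxE (bigD1 (enum_rank (wi n'))) //= big1 ?addr0; last first.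
  by move=> i iw; rewrite mxE -/(wi n') (negbTE iw) andbF mul0r.
by rewrite mxE /= eqxx andbT (inj_eq enum_rank_inj).
Qed.

Lemma sum_delta (F : A -> R) (c : A) : \sum_b (b == c)%:R * F b = F c.
Proof.
rewrite (bigD1 c) //= eqxx mul1r big1 ?addr0// => b /negbTE ->.
by rewrite mul0r.
Qed.

Lemma Bentry_ge0 n n' b a : (n <= n')%N -> 0 <= Bentry n n' b a.
Proof.
move=> nn; rewrite -(subnKC nn); elim: (n' - n)%N b a => [|k IH] b a.
  by rewrite addn0 Bentry_id.
by rewrite addnS Bentry_next ?leq_addr// addr_ge0// mulr_ge0.
Qed.

Lemma norm_B n n' : (n <= n')%N -> mx_norm1 (B T n n') = \sum_b \sum_a Bentry n n' b a.
Proof.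
move=> nn; rewrite /mx_norm1 (reindex (@enum_rank A)) /=; last first.
  by apply: onW_bij; exact: enum_rank_bij.
apply: eq_bigr => b _; rewrite (reindex (@enum_rank A)) /=; last first.
  by apply: onW_bij; exact: enum_rank_bij.
by apply: eq_bigr => a _; rewrite ger0_norm//; exact: Bentry_ge0.
Qed.

Lemma ret_B n n' b : (n <= n')%N ->
  (ret n' b)%:R = \sum_a Bentry n n' b a * (ret n a)%:R.
Proof.
move=> nn; rewrite -(subnKC nn); elim: (n' - n)%N b => [|k IH] b.
  rewrite addn0; under eq_bigr do rewrite Bentry_id eq_sym.
  by rewrite (sum_delta (fun b => (ret n b)%:R)).
rewrite addnS; under eq_bigr do rewrite Bentry_next ?leq_addr// mulrDl -mulrA.
rewrite big_split /= -IH -mulr_sumr -IH.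
by case: eqP => [->|_]; rewrite ?mul1r ?mul0r ?addr0// natrD.
Qed.

Lemma ret_gt0 n b : (0 < ret n b)%N.
Proof. by elim: n b => //= n IH b; case: ifP => // _; rewrite addn_gt0 IH. Qed.

Lemma ret_next_le n b : (ret n b <= ret n.+1 b)%N.
Proof. by rewrite /=; case: ifP => // _; rewrite leq_addr. Qed.

Lemma ret_mono n n' b : (n <= n')%N -> (ret n b <= ret n' b)%N.
Proof.
move=> nn; rewrite -(subnKC nn); elim: (n' - n)%N => [|k]; first by rewrite addn0.
by move=> /leq_trans; apply; rewrite addnS; exact: ret_next_le.
Qed.

(** This is the norm of [B T 0 n]. It exceeds every [hgt n b], so left endpoints at step [n] are
    discontinuities of this order. *)
Definition sret n : nat := (\sum_b ret n b)%N.

Lemma ret_le_sret n b : (ret n b <= sret n)%N.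
Proof. by rewrite /sret (bigD1 b) //= leq_addr. Qed.

Lemma sret_next n : sret n.+1 = (sret n + ret n (wi n))%N.
Proof.
rewrite /sret (bigD1 (lo n)) //= eqxx addnAC [in RHS](bigD1 (lo n)) //=.
congr (_ + _ + _)%N; apply: eq_bigr => b /negbTE bl; by rewrite bl.
Qed.

Lemma sret_ge n : (n <= sret n)%N.
Proof.
elim: n => // n IH; rewrite sret_next; have := ret_gt0 n (wi n); lia.
Qed.

Lemma sret0 : sret 0 = #|A|.
Proof. by rewrite /sret /= sum1_card. Qed.

Lemma sret_norm n n' : (n <= n')%N ->
  (sret n')%:R <= mx_norm1 (B T n n') * (sret n)%:R.
Proof.
move=> nn; rewrite norm_B// natr_sum mulr_suml; apply: ler_sum => b _.
rewrite (ret_B b nn) mulr_suml; apply: ler_sum => a _.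
by rewrite ler_wpM2l ?Bentry_ge0// ler_nat ret_le_sret.
Qed.

Lemma norm_sret n n' (r : R) : (n <= n')%N -> 0 <= r -> (forall a, r <= (ret n a)%:R) ->
  mx_norm1 (B T n n') * r <= (sret n')%:R.
Proof.
move=> nn r0 rP; rewrite norm_B// natr_sum mulr_suml; apply: ler_sum => b _.
rewrite (ret_B b nn) mulr_suml; apply: ler_sum => a _.
by rewrite ler_wpM2l ?Bentry_ge0.
Qed.

Hypotheses (Tpos : pos_len T) (TK : Keane T).
Let tw n := towersP Tpos TK n.

Lemma len_nextE n b :
  len T_[n.+1] b = len T_[n] b - (b == wi n)%:R * len T_[n] (lo n).
Proof. by rewrite len_next; case: eqP => [->|_]; rewrite ?mul1r// mul0r subr0. Qed.

Lemma len_lo_next n : len T_[n.+1] (lo n) = len T_[n] (lo n).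
Proof.
rewrite len_next ifN//; apply/eqP => E; exact: (wi_neq_lo TK (tw n)).
Qed.

Lemma len_B n n' a : (n <= n')%N ->
  len T_[n] a = \sum_b len T_[n'] b * Bentry n n' b a.
Proof.
move=> nn; rewrite -(subnKC nn); elim: (n' - n)%N => [|k IH].
  rewrite addn0; under eq_bigr do rewrite Bentry_id mulrC.
  by rewrite (sum_delta (fun b => len T_[n] b)).
rewrite addnS; under eq_bigr do rewrite Bentry_next ?leq_addr// mulrDr mulrCA.
rewrite big_split /= (sum_delta (fun b => len T_[(n + k).+1] b * _)) len_lo_next.
under eq_bigr do rewrite len_nextE mulrBl -mulrA.
rewrite sumrB -IH (sum_delta (fun b => len T_[(n + k)%N] _ * Bentry n (n + k) b a)).
by rewrite subrK.
Qed.

(** The part cut from the tower of the winner is stacked on the tower of the loser, so the total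
    area is constant. *)
Lemma area n : \sum_b len T_[n] b * (ret n b)%:R = total_len T.
Proof.
elim: n => [|n IH]; first by apply: eq_bigr => b _; rewrite mulr1.
rewrite -IH; have E b : len T_[n.+1] b * (ret n.+1 b)%:R =
    len T_[n] b * (ret n b)%:R - (b == wi n)%:R * (len T_[n] (lo n) * (ret n (wi n))%:R)
    + (b == lo n)%:R * (len T_[n] (lo n) * (ret n (wi n))%:R).
  have wl : (lo n == wi n) = false by apply/eqP => E; apply: (wi_neq_lo TK (tw n)).
  rewrite len_nextE /=; have [->|bl] := eqVneq b (lo n).
    by rewrite wl natrD mulr0n mulr1n; ring.
  by case: eqP => [->|_]; rewrite ?mulr1n ?mulr0n; ring.
under eq_bigr do rewrite E.
rewrite big_split sumrB /= (sum_delta (fun=> _ * _)) (sum_delta (fun=> _ * _)).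
by rewrite subrK.
Qed.

Lemma area_le n b : len T_[n] b * (ret n b)%:R <= total_len T.
Proof.
rewrite -(area n) (bigD1 b) //= lerDl; apply: sumr_ge0 => c _.
by rewrite mulr_ge0// ltW// (tw_pos (tw n)).
Qed.

Lemma len_le_total n b : len T_[n] b <= total_len T_[n].
Proof.
rewrite /total_len (bigD1 b) //= lerDl; apply: sumr_ge0 => c _.
by rewrite ltW// (tw_pos (tw n)).
Qed.

Lemma area_ge n : total_len T <= total_len T_[n] * (sret n)%:R.
Proof.
rewrite -(area n) mulr_suml; apply: ler_sum => b _.
by rewrite ler_wpM2l ?(ltW (tw_pos (tw n) _))// ler_nat ret_le_sret.
Qed.

Lemma total_norm n n' : (n <= n')%N ->
  total_len T_[n] <= mx_norm1 (B T n n') * total_len T_[n'].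
Proof.
move=> nn; rewrite /total_len; under eq_bigr do rewrite (len_B _ nn).
rewrite exchange_big /= norm_B// mulr_suml; apply: ler_sum => b _.
rewrite mulr_suml; apply: ler_sum => a _.
by rewrite mulrC ler_wpM2l ?Bentry_ge0// len_le_total.
Qed.

(** The winner never loses here, so its row of the matrix stays that of the identity, and each step
    adds this row to another one. *)
Lemma norm_same_winner n n' w : (n <= n')%N ->
  (forall i, (n <= i < n')%N -> wi i = w) ->
  mx_norm1 (B T n n') = (#|A| + (n' - n))%:R.
Proof.
move=> nn; rewrite norm_B// -{1 2}(subnKC nn) => ww.
have Bw k a : (k <= n' - n)%N -> Bentry n (n + k) w a = (w == a)%:R.
  elim: k => [|k IH] kn; first by rewrite addn0 Bentry_id.
  rewrite addnS Bentry_next ?leq_addr// IH 1?ltnW//.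
  suff -> : (w == lo (n + k)) = false by rewrite mul0r addr0.
  apply/eqP => E; apply: (wi_neq_lo TK (tw (n + k))).
  by rewrite -E; apply: ww; lia.
elim: (n' - n)%N ww Bw => [|k IH] ww Bw.
  under eq_bigr => b _.
    under eq_bigr => a _ do rewrite addn0 Bentry_id -[_%:R]mulr1 eq_sym.
    rewrite (sum_delta (fun=> 1)); over.
  by rewrite sumr_const addn0.
rewrite addnS; under eq_bigr => b _.
  under eq_bigr do rewrite Bentry_next ?leq_addr//.
  rewrite big_split /= -mulr_sumr; over.
rewrite big_split /= IH; last first.
- by move=> j a jk; apply: Bw; lia.
- by move=> i ik; apply: ww; lia.
rewrite (sum_delta (fun=> _)) (ww (n + k)%N); last by lia.
under eq_bigr do rewrite Bw// -[_%:R]mulr1 eq_sym.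
by rewrite (sum_delta (fun=> 1)) addnS natr1.
Qed.

End Matrices.

(** * Discontinuities of the iterates *)

Section Discontinuities.
Context {R : realType} {A : finType} (T : iem R A) (Tpos : pos_len T).
Implicit Types (x y z : R) (n : nat).
Notation f := (iet_map T).
Notation L := (total_len T).

Lemma disc_zero n : disc T n 0. Proof. by left; left. Qed.

Lemma disc_total n : disc T n L. Proof. by left; right. Qed.

Lemma disc_in n j a x : (j < n)%N -> (1 < pi_t (data T) a)%N ->
  iter j f x = p_ T a -> disc T n x.
Proof.
move=> jn a1 E; right; split; last by exists j, a.
by rewrite -(iter_domain Tpos j) E; exact: domain_p.
Qed.

Lemma discE n x : disc T n x -> [\/ x = 0, x = L |
  domain T x /\ exists j a, [/\ (j < n)%N, (1 < pi_t (data T) a)%N & iter j f x = p_ T a]].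
Proof. by move=> [[->|->]|H]; [apply: Or31|apply: Or32|apply: Or33]. Qed.

Lemma disc_mono m n x : (m <= n)%N -> disc T m x -> disc T n x.
Proof.
move=> mn /discE[->|->|[_ [j [a [jm a1 E]]]]]; [exact: disc_zero|exact: disc_total|].
by apply: disc_in a1 E; lia.
Qed.

Lemma disc_range n x : disc T n x -> 0 <= x <= L.
Proof.
have L0 := total_gt0 Tpos.
by move=> /discE[->|->|[/andP[-> /ltW ->]]//]; rewrite lexx ltW.
Qed.

Lemma p_gt0 a : 0 < p_ T a -> (1 < pi_t (data T) a)%N.
Proof.
have := numbering_ge1 a (pi_tP (data T)); rewrite leq_eqVlt => /orP[/eqP a1|//].
by rewrite /p_ -/(cum _ _ _) (cum_first _ (pi_tP _)) ?ltxx.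
Qed.

Lemma p_succ a : p_ T a + len T a < L ->
  exists2 b, (1 < pi_t (data T) b)%N & p_ T b = p_ T a + len T a.
Proof.
move=> aL; have [_ _ surj] := pi_tP (data T).
have aA : (pi_t (data T) a < #|A|)%N.
  have := numbering_le a (pi_tP (data T)); rewrite leq_eqVlt => /orP[/eqP aA|//].
  by move: aL; rewrite /p_ -/(cum _ _ _) (cum_total _ (pi_tP _)) ?ltxx.
have [|b bE] := surj (pi_t (data T) a).+1; first by rewrite aA.
exists b; last exact: (cum_succ _ (pi_tP _)).
by have := numbering_ge1 a (pi_tP (data T)); lia.
Qed.

Record piece n x a b : Prop := Piece {
  piece_in : a <= x < b;
  piece_l : disc T n a;
  piece_r : disc T n b;
  piece_iter : forall i y, (i <= n)%N -> a <= y < b -> iter i f y = iter i f x + (y - x);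
  piece_disc : forall z, a < z < b -> ~ disc T n z }.

Lemma piece_domain n x a b y : piece n x a b -> a <= y < b -> domain T y.
Proof.
move=> [_ /disc_range/andP[a0 _] /disc_range/andP[_ bL] _ _] /andP[ay yb].
by apply/andP; split; lra.
Qed.

Lemma piece_exists n x : domain T x -> exists a b, piece n x a b.
Proof.
move=> xD; elim: n => [|n [a [b P]]].
  exists 0, L; split; [exact: xD|exact: disc_zero|exact: disc_total| |].
    by move=> i y; rewrite leqn0 => /eqP -> _ /=; rewrite addrC subrK.
  move=> z zL /discE[z0|z1|[_ [j [a []]]]]; last by [].
    by rewrite z0 ltxx in zL.
  by rewrite z1 ltxx andbF in zL.
have [/andP[ax xb] da db Pit Pdisc] := P.
set x' := iter n f x in Pit *.
have x'D : domain T x' by rewrite /x' iter_domain.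
have [c /[dup] cI /andP[cx xc]] := Iv_cover x'D.
have Pn y : a <= y < b -> iter n f y = x' + (y - x) by move=> ?; apply: Pit.
(* The translation by [f^n] carries [za] and [zb] to the ends of the interval of [c]; the new piece
   is the old one cut at these points. *)
pose za := x + (p_ T c - x'); pose zb := x + (p_ T c + len T c - x').
exists (Num.max a za), (Num.min b zb); split.
- by rewrite ge_max lt_min ax xb /= /za /zb; apply/andP; split; lra.
- case: (leP za a) => [_|aza]; first exact: disc_mono da.
  have zaI : a <= za < b by rewrite ltW//= /za; lra.
  have E : iter n f za = p_ T c by rewrite Pn// /za; lra.
  apply: disc_in E => //; apply: p_gt0.
  have : domain T (iter n f a).
    by rewrite iter_domain//; apply: (piece_domain P); rewrite lexx; lra.
  by rewrite Pn ?lexx /=; [|lra]; move=> /andP[]; move: aza; rewrite /za; lra.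
- case: (leP b zb) => [_|zbb]; first exact: disc_mono db.
  have zbI : a <= zb < b by rewrite zbb andbT /zb; lra.
  have E : iter n f zb = p_ T c + len T c by rewrite Pn// /zb; lra.
  have : domain T (iter n f zb) by rewrite iter_domain//; exact: (piece_domain P).
  rewrite E => /andP[_ /p_succ[c' c'1 c'E]]; by apply: (disc_in (ltnSn n) c'1); rewrite E c'E.
- move=> i y; rewrite ge_max lt_min => + /andP[/andP[ay zay] /andP[yb yzb]].
  have yI : a <= y < b by rewrite ay yb.
  rewrite leq_eqVlt => /orP[/eqP ->|]; last by move=> ?; exact: Pit.
  rewrite !iterS Pn// -/x' (iet_mapE Tpos cI) (iet_mapE Tpos (a := c)); first by lra.
  by move: zay yzb; rewrite /Iv /za /zb; lra.
- move=> z; rewrite gt_max lt_min => /andP[/andP[az zaz] /andP[zb' zzb]].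
  move=> /discE[z0|zL|[_ [j [c' [jn c'1 jE]]]]].
  + by move: (disc_range da); lra.
  + by move: (disc_range db); lra.
  move: jn; rewrite ltnS leq_eqVlt => /orP[/eqP jn|jn]; last first.
    by apply: (Pdisc z); [rewrite az zb'|exact: disc_in jE].
  move: jE; rewrite jn Pn ?(ltW az)// => E.
  have c'c : c' = c.
    apply: (Iv_uniq Tpos (x := p_ T c')); first by rewrite /Iv lexx ltrDl Tpos.
    by rewrite /Iv -E; move: zaz zzb; rewrite /za /zb; lra.
  by move: E; rewrite c'c; move: zaz; rewrite /za; lra.
Qed.

Hypotheses (Tadm : admissible (data T)) (TK : Keane T).

(** The left end [a] of the piece of a periodic point is periodic too. If [a] is a preimage of some
    [p_ T c] with [c] not first, this is a connection. If [a = 0], its preimage is [p_ T t] for the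
    first bottom letter [t], which by admissibility is not first on top, so the orbit of 0 gives a
    connection. *)
Lemma aperiodic n x : domain T x -> (0 < n)%N -> iter n f x <> x.
Proof.
move=> xD n0 E; have [a [b P]] := piece_exists n xD.
have [/andP[ax xb] da db Pit Pdisc] := P.
have aE : iter n f a = a.
  by rewrite Pit ?lexx ?(le_lt_trans ax)// E addrC subrK.
have aL : a < L by move: (disc_range db); lra.
have [a0|aL'|[_ [j [c [jn c1 jE]]]]] := discE da; last first.
- apply: TK; exists c, c, n; split => //.
  by rewrite -jE -iterD addnC iterD aE.
- by rewrite aL' ltxx in aL.
rewrite a0 in aE; have [_ _ surj_t] := pi_tP (data T); have [_ _ surj_b] := pi_bP (data T).
have A0 := card_ge2 (data T).
have [|s s1] := surj_t 1%N; first by lia.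
have [|t t1] := surj_b 1%N; first by lia.
have ps : p_ T s = 0 by exact: (cum_first _ (pi_tP _)).
have qt : f (p_ T t) = 0.
  rewrite (iet_mapE Tpos (a := t)); last by rewrite /Iv lexx ltrDl Tpos.
  by rewrite subrr add0r; exact: (cum_first _ (pi_bP _)).
have tE : iter n.-1 f 0 = p_ T t.
  by apply: (iet_map_inj Tpos); rewrite -iterS prednK// qt.
have [st|st] := eqVneq s t.
  apply: (Tadm (k := 1%N)); first by lia.
  have [injt _ _] := pi_tP (data T); have [injb _ _] := pi_bP (data T).
  apply/seteqP; split => c /=.
    have [->|cs] := eqVneq c s; first by rewrite st t1.
    have : pi_t (data T) c <> 1%N by rewrite -s1 => /injt /eqP; rewrite (negbTE cs).
    by have := numbering_ge1 c (pi_tP (data T)); lia.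
  have [->|cs] := eqVneq c t; first by rewrite -st s1.
  have : pi_b (data T) c <> 1%N by rewrite -t1 => /injb /eqP; rewrite (negbTE cs).
  by have := numbering_ge1 c (pi_bP (data T)); lia.
have t2 : (1 < pi_t (data T) t)%N.
  have := numbering_ge1 t (pi_tP (data T)); rewrite leq_eqVlt => /orP[/eqP|//].
  by rewrite -s1 => E1; have [/(_ _ _ E1) /eqP] := pi_tP (data T); rewrite (negbTE st).
apply: TK; exists s, t, n.-1; split; rewrite ?ps//.
case: n n0 {P Pit Pdisc da db E aE} tE => // -[] //= _ E.
by move: t2; rewrite ltnNge => /negP; case; have := cum_gt0 (pi_tP (data T)) Tpos (a := t); move: E; rewrite /p_ -/(cum _ _ _) => <-; rewrite ltxx; lia.
Qed.

(** The form in which (D) is used, freed of the infimum. *)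
Definition disc_separated c := forall n x y, (0 < n)%N -> disc T n x -> disc T n y ->
  x <> y -> c / n%:R <= `|x - y|.

Lemma condD_separated c : (forall n, (1 <= n)%N -> c / n%:R <= Delta T n) -> disc_separated c.
Proof.
move=> H n x y n0 dx dy xy; apply: le_trans (H n n0) _; apply: ge_inf.
  by exists 0 => _ [? [? [_ _ _ ->]]]; exact: normr_ge0.
by exists x, y.
Qed.

Lemma recurrence_lower c n x : 0 < c -> disc_separated c -> domain T x -> (0 < n)%N ->
  c / (n + n)%:R <= `|iter n f x - x|.
Proof.
move=> c0 sep xD n0; have [a [b P]] := piece_exists n xD.
have [/andP[ax xb] da db Pit Pdisc] := P.
have nn0 : 0 < n%:R :> R by rewrite ltr0n.
have cc : c / (n + n)%:R <= c / n%:R.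
  by rewrite ler_pM2l// lef_pV2 ?posrE ?ltr0n ?addn_gt0 ?n0// ler_nat leq_addr.
(* A displacement of at least [c / n] suffices; a smaller one is shorter than the piece. *)
have [|xn] := leP (c / n%:R) `|iter n f x - x|; first exact: le_trans.
have ab : c / n%:R <= b - a.
  have abn : b <> a by move=> E; move: ax xb; rewrite E; lra.
  have := sep n _ _ n0 db da abn.
  by rewrite gtr0_norm// subr_gt0; exact: le_lt_trans xb.
have Pn y : a <= y < b -> iter n f y = y + (iter n f x - x).
  by move=> ?; rewrite Pit//; lra.
have hit z e : a <= z < b -> iter n f z = e -> e != 0 -> disc T n e -> disc T (n + n) z.
  move=> zI zE e0 /discE[e0'|eL|[_ [j [d [jn d1 jE]]]]].
  - by rewrite e0' eqxx in e0.
  - have : domain T (iter n f z) by rewrite iter_domain//; exact: piece_domain P zI.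
    by rewrite zE eL => /andP[_]; rewrite ltxx.
  - by apply: (@disc_in _ (j + n)%N d); rewrite // ?iterD ?zE//; lia.
have mono y : disc T n y -> disc T (n + n) y by apply: disc_mono; rewrite leq_addr.
have nn : (0 < n + n)%N by lia.
set d := iter n f x - x in xn Pn *.
(* For [d < 0] the point [a - d] of the piece is sent to [a], for [d > 0] the point [b - d] is sent
   to [b]; either is a discontinuity of order [n + n] at distance [|d|] from an end. *)
have [d0|d0|d0] := ltgtP d 0.
- rewrite ltr0_norm// in xn *; have zI : a <= a - d < b by lra.
  have a0 : a != 0.
    apply/eqP => a0; have : domain T (iter n f a).
      by rewrite iter_domain//; apply: (piece_domain P); lra.
    by rewrite Pn; [move=> /andP[]; lra|lra].
  have za : a - d <> a by lra.
  have zn : iter n f (a - d) = a by rewrite Pn//; lra.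
  have := sep _ _ _ nn (hit _ _ zI zn a0 da) (mono _ da) za.
  by rewrite addrAC subrr sub0r gtr0_norm// oppr_gt0.
- rewrite gtr0_norm// in xn *; have zI : a <= b - d < b by lra.
  have b0 : b != 0 by have := disc_range da; apply: contraTneq => b0; lra.
  have zb : b - d <> b by lra.
  have zn : iter n f (b - d) = b by rewrite Pn//; lra.
  have := sep _ _ _ nn (hit _ _ zI zn b0 db) (mono _ db) zb.
  by rewrite addrAC subrr sub0r normrN gtr0_norm.
- by exfalso; apply: (aperiodic xD n0); move: d0; rewrite /d; lra.
Qed.

End Discontinuities.

Arguments disc_separated {R A} T c.

(** * Return times *)

Section Packing.
Context {R : realType}.

Lemma packing (I : finType) (x l : I -> R) n (S : {set I}) (X : R) : (#|S| <= n)%N ->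
  0 <= X -> (forall i, i \in S -> [/\ 0 < l i, 0 <= x i & x i + l i <= X]) ->
  (forall i j, i \in S -> j \in S -> i != j -> x i + l i <= x j \/ x j + l j <= x i) ->
  \sum_(i in S) l i <= X.
Proof.
elim: n S X => [|n IH] S X Sn X0 SX disj.
  by rewrite big_pred0// => i; move: Sn; rewrite leqn0 cards_eq0 => /eqP ->; rewrite inE.
have [->|[i0 i0S]] := set_0Vmem S; first by rewrite big_set0.
(* The interval of [m] is the rightmost one; the others fit to the left of [x m]. *)
case: (@arg_maxP _ R _ i0 (mem S) x i0S) => m mS' mmax; have mS : m \in S by exact: mS'.
have [lm xm xmX] := SX m mS.
rewrite (big_setD1 m)//=; apply: le_trans xmX; rewrite addrC lerD2r.
apply: IH => //.
- by move: Sn; rewrite (cardsD1 m) mS.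
- move=> i; rewrite !inE => /andP[im iS]; have [li xi _] := SX i iS; split => //.
  by have [//|] := disj i m iS mS im; have xim : x i <= x m := mmax i iS; lra.
- by move=> i j; rewrite !inE => /andP[_ iS] /andP[_ jS]; exact: disj.
Qed.

(** Each doubling of the range adds [m] terms with denominators at most [3 * m], thus at least one
    third. *)
Lemma harmonic_lower h t : (0 < h)%N ->
  t%:R / 3%:R <= \sum_(j < 2 ^ t * h) ((j + h)%:R)^-1 :> R.
Proof.
move=> h0; elim: t => [|t IH]; first by rewrite mul0r; apply: sumr_ge0.
pose m := (2 ^ t * h)%N; have m0 : (0 < m)%N by rewrite muln_gt0 expn_gt0 h0.
rewrite expnS -mulnA mul2n -addnn big_split_ord /= -natr1 mulrDl mul1r lerD//.
apply: (@le_trans _ _ (\sum_(j < m) ((3 * m)%:R)^-1)).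
  rewrite sumr_const card_ord -[X in _ <= X]mulr_natr natrM invfM -mulrA mulVf ?mulr1//.
  by rewrite pnatr_eq0 -lt0n.
apply: ler_sum => j _; rewrite lef_pV2 ?posrE ?ltr0n ?ler_nat; try lia.
have : (h <= m)%N by rewrite /m leq_pmull// expn_gt0.
by have := ltn_ord j; rewrite -/m; lia.
Qed.

End Packing.

(** * Linear recurrence from separated discontinuities *)

Section Recurrence.
Context {R : realType} {A : finType} (T : iem R A) (Tpos : pos_len T).
Implicit Types (x y z : R) (n : nat).
Notation f := (iet_map T).
Notation L := (total_len T).

(** A point that [f^i] sends to an interior discontinuity of [f^h] is a discontinuity of
    [f^(i + h)], which the open piece excludes. The values 0 and [L] are excluded because the image
    of the piece stays in the domain. *)
Lemma piece_no_cross n h i x a b z e : piece T n x a b -> disc T h e ->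
  (i + h <= n)%N -> a < z < b -> iter i f z <> e.
Proof.
move=> P de ihn /andP[az zb] E; have [/andP[ax xb] da db Pit Pdisc] := P.
have aD : domain T a by apply: (piece_domain Tpos P); lra.
have zD : domain T z by apply: (piece_domain Tpos P); lra.
have [e0|eL|[_ [j [c [jh c1 jE]]]]] := discE de.
- have : domain T (iter i f a) by rewrite iter_domain.
  have Pa : iter i f a = iter i f x + (a - x) by apply: Pit; [lia|lra].
  have Pz : iter i f z = iter i f x + (z - x) by apply: Pit; [lia|lra].
  by move=> /andP[+ _]; rewrite Pa; rewrite Pz e0 in E; lra.
- have : domain T (iter i f z) by rewrite iter_domain.
  by rewrite E eL => /andP[_]; rewrite ltxx.
- apply: (Pdisc z); first by rewrite az.
  by apply: (@disc_in _ _ _ Tpos _ (j + i) c); rewrite // ?iterD ?E//; lia.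
Qed.

(** An image of the piece with points on both sides of [a0] or [b0] would take that value in its
    interior. *)
Lemma piece_side n h i x a b a0 b0 y y' : piece T n x a b ->
  disc T h a0 -> disc T h b0 -> (i + h <= n)%N -> a <= y < b -> a <= y' < b ->
  a0 <= iter i f y < b0 -> a0 <= iter i f y' < b0.
Proof.
move=> P da0 db0 ihn yI y'I /andP[ya yb]; have [_ _ _ Pit _] := P.
have Py : iter i f y = iter i f x + (y - x) by apply: Pit => //; lia.
have Py' : iter i f y' = iter i f x + (y' - x) by apply: Pit => //; lia.
apply/andP; split.
  rewrite leNgt; apply/negP => lt.
  have zI : a < y' + (a0 - iter i f y') < b by lra.
  apply: (piece_no_cross P da0 ihn zI); rewrite Pit; [|lia|lra].
  by rewrite Py'; lra.
rewrite ltNge; apply/negP => le.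
have zI : a < y' + (b0 - iter i f y') < b by lra.
apply: (piece_no_cross P db0 ihn zI); rewrite Pit; [|lia|lra].
by rewrite Py'; lra.
Qed.

(* If x does not return before time C h, the images under f^j of its piece of
   continuity for f^(j + h), for j < C h, are disjoint. *)
Lemma linear_recurrence c : 0 < c -> disc_separated T c ->
  exists C : nat, forall h a0 b0 x, (0 < h)%N -> disc T h a0 -> disc T h b0 ->
    a0 <= x < b0 -> exists2 i, (0 < i <= C * h)%N & a0 <= iter i f x < b0.
Proof.
(* With this [t] the lower bound [c * t / 3] for the total length of the disjoint images exceeds
   [L]. *)
move=> c0 sep; pose t := (Num.truncn (L / (c / 3%:R))).+1.
have tP : L < c * (t%:R / 3%:R).
  have : L / (c / 3%:R) < t%:R by exact: truncnS_gt.
  by rewrite ltr_pdivrMr ?divr_gt0//; lra.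
exists (2 ^ t)%N => h a0 b0 x h0 da0 db0 /andP[ax xb].
apply: contrapT => H.
have {}H i : (0 < i <= 2 ^ t * h)%N -> ~ a0 <= iter i f x < b0.
  by move=> iP Ji; apply: H; exists i.
have xD : domain T x.
  by have := disc_range Tpos da0; have := disc_range Tpos db0; rewrite /domain /=; lra.
set m := (2 ^ t * h)%N in H *.
have /choice[a_ /choice[b_ Pab]] : forall j : 'I_m, exists a, exists b, piece T (j + h) x a b.
  by move=> j; exact: piece_exists.
pose l (j : 'I_m) : R := c / (j + h)%:R.
have l0 j : 0 < l j by rewrite divr_gt0// ltr0n; lia.
have lab j : l j <= b_ j - a_ j.
  have [/andP[axj xbj] da db _ _] := Pab j.
  have ba : b_ j <> a_ j by move=> E; move: axj xbj; rewrite E; lra.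
  have jh : (0 < j + h)%N by lia.
  have := sep _ _ _ jh db da ba; rewrite gtr0_norm// subr_gt0.
  exact: le_lt_trans xbj.
pose X (j : 'I_m) := iter j f (a_ j).
have XP j y : a_ j <= y < b_ j -> iter j f y = X j + (y - a_ j).
  move=> yI; have [axb _ _ Pit _] := Pab j; have jj : (j <= j + h)%N by lia.
  by rewrite /X (Pit _ _ jj yI) (Pit _ (a_ j) jj); [lra|move: axb => /andP[]; lra].
have disj i j : i != j -> X i + l i <= X j \/ X j + l j <= X i.
  wlog ij : i j / (i < j)%N => [hw nij|_].
    case: (ltngtP i j) => [lt|lt|E]; first exact: hw.
    - by have [] := hw j i lt; rewrite 1?eq_sym; [|right|left].
    - by move: nij; rewrite (val_inj E) eqxx.
  have [|lt1] := leP (X i + l i) (X j); first by left.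
  have [|lt2] := leP (X j + l j) (X i); first by right.
  pose w := Num.max (X i) (X j).
  have wP : X i <= w < X i + l i /\ X j <= w < X j + l j.
    by rewrite /w; case: (leP (X i) (X j)); have := l0 i; have := l0 j; lra.
  have yI : a_ i <= a_ i + (w - X i) < b_ i by have := lab i; lra.
  have yJ : a_ j <= a_ j + (w - X j) < b_ j by have := lab j; lra.
  have Yi : iter i f (a_ i + (w - X i)) = w by rewrite XP//; lra.
  have Yj : iter j f (a_ j + (w - X j)) = w by rewrite XP//; lra.
  (* Cancelling [f^i], a point of the [j]-th piece reaches the [i]-th piece at time [j - i]. Neither
     piece straddles an end of [[a0, b0)], so [x] itself would return at that time. *)
  have E : a_ i + (w - X i) = iter (j - i) f (a_ j + (w - X j)).
    by apply: (iter_inj Tpos (n := i)); rewrite -iterD subnKC ?Yi// ltnW.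
  exfalso; apply: (H (j - i)%N).
    by rewrite subn_gt0 ij (leq_trans (leq_subr _ _))// ltnW.
  have [xI _ _ _ _] := Pab j; have [xI' _ _ _ _] := Pab i.
  apply: (piece_side (Pab j) da0 db0 _ yJ xI); first by rewrite leq_add2r leq_subr.
  rewrite -E; apply: (piece_side (i := 0) (Pab i) da0 db0 _ xI' yI) => //=; first by rewrite leq_addl.
  by rewrite ax.
suff : \sum_(j in [set: 'I_m]%SET) l j <= L.
  rewrite (eq_bigl xpredT); last by move=> j; rewrite inE.
  rewrite -mulr_sumr => le; have := @harmonic_lower R h t h0.
  by rewrite -(ler_pM2l c0); move: tP le; rewrite -/m; lra.
apply: (packing (x := X) (n := m)).
- by rewrite cardsE card_ord.
- exact: ltW (total_gt0 Tpos).
- move=> j _; have := l0 j; have := lab j; have [xI _ _ _ _] := Pab j => ab lj; split => //.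
    have : domain T (X j).
      by rewrite iter_domain//; apply: (piece_domain Tpos (Pab j)); lra.
    by move=> /andP[].
  rewrite leNgt; apply/negP => lt.
  have XL : X j < L.
    have : domain T (X j).
      by rewrite iter_domain//; apply: (piece_domain Tpos (Pab j)); lra.
    by move=> /andP[].
  have yI : a_ j <= a_ j + (L - X j) < b_ j by lra.
  have : domain T (iter j f (a_ j + (L - X j))).
    by rewrite iter_domain//; exact: (piece_domain Tpos (Pab j)).
  by rewrite XP// => /andP[_]; lra.
- by move=> i j _ _; exact: disj.
Qed.

End Recurrence.

(** * Visits to the intervals of the induced maps and bounds on return times *)

Section Visits.
Context {R : realType} {A : finType} (T : iem R A).
Implicit Types (a b c : A) (x y z : R) (n : nat).
Notation "T_[ n ]" := (iem_at T n) (at level 0, format "T_[ n ]").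
Notation wi := (wi T). Notation lo := (lo T). Notation top := (top T).
Notation ret := (ret T). Notation hgt := (hgt T). Notation sret := (sret T).
Notation f := (iet_map T).
Notation L := (total_len T).
Hypotheses (Tpos : pos_len T) (TK : Keane T).
Let tw n := towersP Tpos TK n.
Let pos n := tw_pos (tw n).

Lemma Iv_p n b : Iv T_[n] b (p_ T_[n] b).
Proof. by rewrite /Iv lexx ltrDl; exact: pos. Qed.

Lemma Iv_split n b x : Iv T_[n] b x ->
  exists2 u, 0 <= u < len T_[n] b & x = p_ T_[n] b + u.
Proof.
move=> /andP[bx xb]; exists (x - p_ T_[n] b); last by rewrite addrC subrK.
by apply/andP; split; lra.
Qed.

Definition visits s a n b := (s <= n)%N /\
  exists2 i, (i < ret n b)%N & forall x, Iv T_[n] b x -> Iv T_[s] a (iter i f x).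

Lemma visits_self s a : visits s a s a.
Proof. by split=> //; exists 0%N => //; exact: ret_gt0. Qed.

Lemma visits_spreading s a : spreading wi lo (visits s a).
Proof.
move=> n.
have [H1 H2 H3 H4] := tower_step_lo TK (tw n).
set c := if top n then lo n else wi n in H1 H3.
set d := if top n then wi n else lo n in H2 H4.
have rE : (ret n.+1 (lo n) = ret n d + ret n c)%N.
  by rewrite /= eqxx /c /d; case: (top n); rewrite // addnC.
have lol x : Iv T_[n.+1] (lo n) x ->
    exists2 u, 0 <= u < len T_[n] (lo n) & x = p_ T_[n.+1] (lo n) + u.
  by move=> /Iv_split; rewrite (len_lo_next Tpos TK).
have vc : visits s a n c -> visits s a n.+1 (lo n).
  move=> [sn [i ic iP]]; split; first exact: leqW.
  exists i; first by rewrite rE ltn_addl.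
  by move=> x /lol[u uP ->]; apply: iP; exact: H3.
have vd : visits s a n d -> visits s a n.+1 (lo n).
  move=> [sn [i ic iP]]; split; first exact: leqW.
  exists (i + ret n c)%N; first by rewrite rE ltn_add2r.
  by move=> x /lol[u uP ->]; rewrite iterD H1//; apply: iP; exact: H4.
split=> [b|]; last by move: vc vd; rewrite /c /d; case: (top n).
have [->|bl] := eqVneq b (lo n); first by move: vc vd; rewrite /c /d; case: (top n).
move=> [sn [i ib iP]]; split; first exact: leqW.
exists i; first by rewrite /= (negbTE bl).
have lb := len_next_le b (tw n).
move=> x /andP[bx xb]; apply: iP; move: bx xb; rewrite /Iv (p_next TK (tw n))// => -> xb.
by apply: (lt_le_trans xb); rewrite lerD2l.
Qed.

(** At a step where every tower visits both intervals, start from the level in [a] of a tower, leave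
    it through the top, and climb the next tower up to its level in [b]. *)
Lemma visit_order s a b : exists2 x, Iv T_[s] a x & exists k, Iv T_[s] b (iter k f x).
Proof.
have [e1 se1 v1] := spreading_total Tpos TK (visits_spreading s a) (visits_self s a).
have [e2 se2 v2] := spreading_total Tpos TK (visits_spreading s b) (visits_self s b).
pose e := maxn e1 e2.
have {}v1 c : visits s a e c by apply: (spreading_mono (visits_spreading s a) _ (v1 c)); rewrite leq_maxl.
have {}v2 c : visits s b e c by apply: (spreading_mono (visits_spreading s b) _ (v2 c)); rewrite leq_maxr.
have [_ [i ia iP]] := v1 a; exists (iter i f (p_ T_[e] a)); first exact/iP/Iv_p.
have /Iv_cover[b' b'I] : domain T_[e] (q_ T_[e] a).
  have := cum_le_total a (pi_bP (data T_[e])) (pos e).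
  have := cum_ge0 (pi_b (data T_[e])) a (pos e); have := pos e a.
  by rewrite /domain /= /q_ /cum /total_len; lra.
have [_ [j jb' jP]] := v2 b'.
exists (j + (ret e a - i))%N; rewrite -iterD -addnA subnK; last exact: ltnW.
by rewrite iterD (translates0 (tw e) (tw_ret (tw e) a)); exact: jP.
Qed.

(* The tower over the interval of a letter contains its previous intervals as
   long as the letter does not win. *)
Lemma non_winner n n' a : (n <= n')%N -> (forall i, (n <= i < n')%N -> wi i <> a) ->
  len T_[n'] a = len T_[n] a /\ exists2 m, (m < ret n' a)%N &
    translates T m (p_ T_[n'] a) (p_ T_[n] a) (len T_[n'] a).
Proof.
move=> nn; rewrite -(subnKC nn); elim: (n' - n)%N => [_|k IH wa].
  by rewrite addn0; split=> //; exists 0%N; [exact: ret_gt0|].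
have [|lE [m mr mP]] := IH; first by move=> i ik; apply: wa; lia.
have wka : wi (n + k) <> a by apply: wa; lia.
have lE' : len T_[(n + k).+1] a = len T_[(n + k)%N] a.
  by rewrite len_next ifN//; apply/eqP => E; exact: wka.
rewrite addnS lE'; split=> //.
have [al|al] := eqVneq a (lo (n + k)); last first.
  exists m; first by rewrite /= (negbTE al).
  by rewrite (p_next TK (tw _)).
have [H1 _ _ _] := tower_step_lo TK (tw (n + k)).
rewrite -al in H1; case: (boolP (top (n + k))) H1 => tn H1.
  exists m; first by rewrite /= al eqxx -al ltn_addr.
  by rewrite /= p_induction_top.
have E : a = alpha_t (data T_[(n + k)%N]) by rewrite al /lo /los ifN.
exists (m + ret (n + k) (wi (n + k)))%N; first by rewrite /= al eqxx -al ltn_add2r.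
apply: (translates_comp (lexx _) H1).
have -> // : total_len T_[(n + k)%N] - len T_[(n + k)%N] a = p_ T_[(n + k)%N] a.
by rewrite [in RHS]E p_alpha_t -E.
Qed.

Lemma disc_left n a : disc T (sret n) (p_ T_[n] a).
Proof.
have [a1|a1] := boolP (1 < pi_t (data T_[n]) a)%N; last first.
  rewrite /p_ -/(cum _ _ _) (cum_first _ (pi_tP _)); first exact: disc_zero.
  by have := numbering_ge1 a (pi_tP (data T_[n])); lia.
apply: (@disc_in _ _ _ Tpos _ (hgt n a) a).
- exact: leq_trans (tw_hgt_lt (tw n) a) (ret_le_sret _ _ _).
- by rewrite -(tw_first (tw n)).
- exact: (translates0 (tw n) (tw_hgt (tw n) a)).
Qed.

Lemma disc_right n a : a <> alpha_t (data T_[n]) ->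
  disc T (sret n) (p_ T_[n] a + len T_[n] a).
Proof.
move=> aA; suff /p_succ[b _ <-] : p_ T_[n] a + len T_[n] a < total_len T_[n].
  exact: disc_left.
have /(cum_lt (pi_tP _) (pos n)) : (pi_t (data T_[n]) a < pi_t (data T_[n]) (alpha_t (data T_[n])))%N.
  rewrite alpha_tP ltn_neqAle numbering_le ?andbT; last exact: pi_tP.
  by rewrite -(alpha_tP (data T_[n])); apply/eqP => /(let: And3 i _ _ := pi_tP (data T_[n]) in i).
move=> /le_lt_trans; apply.
have : p_ T_[n] (alpha_t (data T_[n])) < total_len T_[n].
  by rewrite p_alpha_t gtrBl; exact: pos.
by [].
Qed.

(** As [a] does not win, its right endpoint at step [n.+1] is already one at step [n], of [a] or of
    the winner, and of a letter not last on top; so it is a left endpoint as well. *)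
Lemma disc_ends n a : wi n <> a ->
  disc T (2 * sret n)%N (p_ T_[n.+1] a) /\
  disc T (2 * sret n)%N (p_ T_[n.+1] a + len T_[n.+1] a).
Proof.
move=> wa; have s2 : (sret n.+1 <= 2 * sret n)%N.
  by rewrite sret_next; have := ret_le_sret T n (wi n); lia.
split; first exact: disc_mono s2 (disc_left _ _).
have len_a : len T_[n.+1] a = len T_[n] a.
  by rewrite len_next ifN//; apply/eqP => E; exact: wa.
have sle : (sret n <= 2 * sret n)%N by lia.
apply: (disc_mono Tpos sle); have [aA|aA] := eqVneq a (alpha_t (data T_[n])); last first.
  have E : p_ T_[n.+1] a = p_ T_[n] a.
    have [al|al] := eqVneq a (lo n); last by rewrite (p_next TK (tw n)).
    have tn : top n.
      by apply: contraT => /negbTE tn; move: aA; rewrite al /lo /los [top_type _]tn eqxx.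
    by rewrite /= p_induction_top.
  by rewrite E len_a; apply: disc_right; exact/eqP.
have tn : top n = false.
  by apply/negP => tn; apply: wa; rewrite /wi /win [top_type _]tn.
have al : a = lo n by rewrite /lo /los [top_type _]tn.
have -> : p_ T_[n.+1] a + len T_[n.+1] a = p_ T_[n] (wi n) + len T_[n] (wi n).
  rewrite len_a /= p_induction_bot//; last exact: (wi_neq_lo TK (tw n)).
  by rewrite -/(wi n) -/(lo n) al eqxx subrK.
by apply: disc_right; rewrite -aA.
Qed.

Lemma ret_bound (C : nat) n n' a b :
  (forall h y z x, (0 < h)%N -> disc T h y -> disc T h z ->
    y <= x < z -> exists2 i, (0 < i <= C * h)%N & y <= iter i f x < z) ->
  (n < n')%N -> (forall i, (n <= i < n')%N -> wi i <> a) ->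
  (ret n' b <= C * (2 * sret n))%N.
Proof.
move=> rec nn wa; set h := (2 * sret n)%N.
have h0 : (0 < h)%N by rewrite muln_gt0 /= (leq_trans (ret_gt0 T n a) (ret_le_sret _ _ _)).
have wna : wi n <> a by apply: wa; lia.
have [d1 d2] := disc_ends wna.
have [|lE [m mr mP]] := @non_winner n.+1 n' a nn; first by move=> i ik; apply: wa; lia.
(* The map [f^m] carries the interval of [a] at step [n'] onto the one at step [n.+1], so the return
   times of the latter apply to the former. *)
have back x : Iv T_[n'] a x -> exists2 i, (0 < i <= C * h)%N & Iv T_[n'] a (iter i f x).
  move=> /Iv_split[u uP ->]; have vI : p_ T_[n.+1] a <= p_ T_[n.+1] a + u < p_ T_[n.+1] a + len T_[n.+1] a.
    by rewrite -lE; lra.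
  have [i iP /andP[v1 v2]] := rec _ _ _ _ h0 d1 d2 vI.
  exists i => //; rewrite -mP// -iterD addnC iterD in v1 v2.
  set y := iter i f _ in v1 v2 *.
  pose v := iter m f y - p_ T_[n.+1] a.
  have v0 : 0 <= v < len T_[n'] a by rewrite /v lE; lra.
  have : iter m f (p_ T_[n'] a + v) = iter m f y by rewrite mP// /v addrC subrK.
  by move=> /(iter_inj Tpos) <-; rewrite /Iv; lra.
have orbit k x : Iv T_[n'] a x ->
    exists2 i, (0 < i <= C * h)%N & Iv T_[n'] a (iter i f (iter k f x)).
  elim/ltn_ind: k x => k IH x xI; have [i iP iI] := back x xI.
  have [ki|ik] := ltnP k i.
    by exists (i - k)%N; [lia|rewrite -iterD subnK// ltnW].
  have [|j jP] := IH (k - i)%N _ _ iI; first by lia.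
  by rewrite -[iter (k - i) f _]iterD subnK//; exists j.
(* The orbit of [x] meets the interval of [b] at time [k] and is back in that of [a] within [C * h]
   steps; so the return to the domain takes no longer. *)
have [x xI [k kI]] := visit_order n' a b.
have [i iP iI] := orbit k x xI.
have iD := Iv_domain (pos n') iI.
rewrite leqNgt; apply/negP => lt; apply: (tw_return (tw n') kI (i := i)) iD.
by apply/andP; split; lia.
Qed.

End Visits.

(** * The Marmi-Moussa-Yoccoz acceleration *)

Section MarmiMoussaYoccoz.
Context {R : realType} {A : finType} (T : iem R A).
Implicit Types (a b : A) (x y z c : R) (n k : nat).
Notation "T_[ n ]" := (iem_at T n) (at level 0, format "T_[ n ]").
Notation wi := (wi T). Notation lo := (lo T). Notation top := (top T).
Notation ret := (ret T). Notation hgt := (hgt T). Notation sret := (sret T).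
Notation f := (iet_map T).
Notation L := (total_len T).
Hypotheses (Tpos : pos_len T) (TK : Keane T).
Let tw n := towersP Tpos TK n.
Let pos n := tw_pos (tw n).

Lemma largest_above_ex (P : nat -> Prop) s e : P s.+1 ->
  (forall j, P j -> (j <= e)%N) -> exists m, largest_above P s m.
Proof.
move=> Ps Pe; have exP : exists j, `[<P j>] by exists s.+1; apply/asboolP.
have bP j : `[<P j>] -> (j <= e)%N by move=> /asboolP/Pe.
case: (ex_maxnP exP bP) => m /asboolP Pm mmax; exists m; split=> //.
- exact/mmax/asboolP.
- by move=> j Pj; apply: mmax; apply/asboolP.
Qed.

Lemma largest_times (P : nat -> nat -> Prop) :
  (forall s, exists m, largest_above (P s) s m) ->
  exists t : nat -> nat, t 0%N = 0%N /\
    forall k, largest_above (P (t k)) (t k) (t k.+1).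
Proof. by move=> /choice[g gP]; exists (fun k => iter k g 0%N); split => //= k. Qed.

Lemma gamma_winners s e : [seq winner g | g <- gamma T s e] = [seq wi i | i <- index_iota s e].
Proof. by rewrite /gamma -map_comp. Qed.

Lemma not_all_winnersP s e : not_all_winners (gamma T s e) <->
  exists a, forall i, (s <= i < e)%N -> wi i <> a.
Proof.
split=> -[a aP]; exists a.
  move=> i ise E; move: aP; rewrite gamma_winners -E map_f//.
  by rewrite mem_index_iota.
rewrite gamma_winners; apply/mapP => -[i]; rewrite mem_index_iota => ise E.
exact: (aP i ise).
Qed.

Lemma MMY_times_ex : exists m, MMY_times T m.
Proof.
apply: (@largest_times (fun s j => not_all_winners (gamma T s j))) => s.
have [e se we] := win_all_ex Tpos TK s.
apply: (@largest_above_ex _ s e).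
  apply/not_all_winnersP; exists (lo s) => i isi.
  have -> : i = s by lia.
  exact: wi_neq_lo (tw s).
move=> j /not_all_winnersP[a aP]; rewrite leqNgt; apply/negP => ej.
by have [i ise] := we a; apply: aP; lia.
Qed.

(** All letters win in a block followed by one more step, so two blocks are taken for each of the
    [2 * #|A|] stretches of [spreading_all]. *)
Definition mmy_gap := (2 * (2 * #|A|))%N.

Section Times.
Context (m : nat -> nat) (mP : MMY_times T m).

Lemma mmy_lt k : (m k < m k.+1)%N.
Proof. by have [_ /(_ k)[]] := mP. Qed.

Lemma mmy_mono j k : (j <= k)%N -> (m j <= m k)%N.
Proof.
move=> jk; rewrite -(subnKC jk); elim: (k - j)%N => [|i IH]; first by rewrite addn0.
by apply: (leq_trans IH); rewrite addnS ltnW// mmy_lt.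
Qed.

Lemma mmy_ge k : (k <= m k)%N.
Proof. by elim: k => // k IH; exact: leq_ltn_trans IH (mmy_lt k). Qed.

Lemma mmy_win_all k : win_all wi (m k) (m k.+1).+1.
Proof.
move=> a; apply: contrapT => H; have [_ /(_ k)[_ _ maxm]] := mP.
suff /maxm : not_all_winners (gamma T (m k) (m k.+1).+1) by rewrite ltnn.
by apply/not_all_winnersP; exists a => i ik wa; apply: H; exists i.
Qed.

Lemma mmy_spreading P k a : spreading wi lo P -> P (m k) a ->
  forall b, P (m (k + mmy_gap)%N) b.
Proof.
move=> Psp Pa b.
apply: (spreading_all (wi_next T) Psp (t := fun j => m (k + 2 * j)%N) (a := a)).
  move=> j c; have [i iP wc] := mmy_win_all (k + 2 * j)%N c; exists i => //.
  have := mmy_lt (k + 2 * j)%N.+1; have -> : (k + 2 * j.+1 = (k + 2 * j).+2)%N by lia.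
  lia.
by rewrite muln0 addn0.
Qed.

Lemma mmy_ret k a b : (ret (m k) a <= ret (m (k + mmy_gap)%N) b)%N.
Proof.
apply: (@mmy_spreading (fun n b => (ret (m k) a <= ret n b)%N) k a) => // n.
split=> [c /leq_trans|/leq_trans]; apply; first exact: ret_next_le.
by rewrite /= eqxx leq_addl.
Qed.

Lemma mmy_len k a b : len T_[m (k + mmy_gap)%N] b <= len T_[m k] a.
Proof.
apply: (@mmy_spreading (fun n b => len T_[n] b <= len T_[m k] a) k a) => // n.
split=> [c|]; apply: le_trans; first exact: len_next_le.
by rewrite (len_lo_next Tpos TK) ltW//; exact: len_lo_lt.
Qed.

(** Going back [mmy_gap] blocks costs a factor [K ^+ mmy_gap], and the return times there are at
    most [ret (m k) a]. For small [k] the comparison starts from [sret 0 = #|A|]. *)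
Lemma mmy_sret_ret (K : R) : 1 <= K ->
  (forall k, (sret (m k.+1))%:R <= K * (sret (m k))%:R) ->
  forall k a, (sret (m k))%:R <= K ^+ mmy_gap * #|A|%:R * (ret (m k) a)%:R.
Proof.
move=> K1 HK k a; have K0 : 0 <= K by exact: le_trans K1.
have grow i j : (sret (m (i + j)%N))%:R <= K ^+ j * (sret (m i))%:R.
  elim: j => [|j IH]; first by rewrite addn0 expr0 mul1r.
  by rewrite addnS exprS -mulrA; apply: (le_trans (HK _)); rewrite ler_wpM2l.
have [kS|Sk] := ltnP k mmy_gap.
  have := grow 0%N k; have [-> _] := mP; rewrite sret0 add0n => /le_trans; apply.
  rewrite -[X in X <= _]mulr1 ler_pM// ?mulr_ge0 ?exprn_ge0//.
    by rewrite ler_wpM2r// ler_weXn2l// ltnW.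
  by rewrite ler1n ret_gt0.
rewrite -(subnK Sk); apply: (le_trans (grow _ _)).
rewrite -mulrA ler_wpM2l ?exprn_ge0// -natrM ler_nat.
rewrite -sum_nat_const; apply: leq_sum => b _; exact: mmy_ret.
Qed.

(** The return times at [m k] being comparable to their sum, the norm is bounded by the ratio of
    consecutive sums, up to a constant. *)
Lemma condA_of_bounds (K : R) : 1 <= K ->
  (forall k, (sret (m k.+1))%:R <= K * (sret (m k))%:R) -> condA T.
Proof.
move=> K1 HK; have K0 : 0 < K by exact: lt_le_trans K1.
pose Q := K ^+ mmy_gap * #|A|%:R.
have Q0 : 0 < Q by rewrite mulr_gt0 ?exprn_gt0// ltr0n (letters_gt0 (data T)).
exists m => //; exists (K * Q) => k.
have s0 : 0 < (sret (m k))%:R :> R.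
  by rewrite ltr0n; exact: leq_trans (ret_gt0 T _ (wi 0)) (ret_le_sret _ _ _).
have nn : (m k <= m k.+1)%N by rewrite ltnW// mmy_lt.
have := @norm_sret _ _ T _ _ ((sret (m k))%:R / Q) nn.
move=> /(_ (ltW (divr_gt0 s0 Q0))) H.
have {}H : mx_norm1 (B T (m k) (m k.+1)) * ((sret (m k))%:R / Q) <= (sret (m k.+1))%:R.
  by apply: H => a; rewrite ler_pdivrMr// mulrC; exact: mmy_sret_ret.
have := le_trans H (HK k); rewrite mulrA ler_pdivrMr// mulrAC.
by rewrite ler_pM2r.
Qed.

End Times.

Lemma separated_condA (c : R) : 0 < c -> disc_separated T c -> condA T.
Proof.
move=> c0 sep; have [C rec] := linear_recurrence Tpos c0 sep.
have [m mP] := MMY_times_ex.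
have bound k : (sret (m k.+1) <= #|A| * (C * 2) * sret (m k))%N.
  have [_ /(_ k)[lt /not_all_winnersP[a aP] _]] := mP.
  rewrite -!mulnA -sum_nat_const; apply: leq_sum => b _.
  exact: (ret_bound Tpos TK b rec lt aP).
have K0 : (0 < #|A| * (C * 2))%N.
  have := bound 0%N; rewrite lt0n; case: eqP => // ->; rewrite mul0n leqn0 => /eqP E.
  by have := leq_trans (ret_gt0 T (m 1%N) (wi 0)) (ret_le_sret _ _ _); rewrite E.
apply: (condA_of_bounds mP (K := (#|A| * (C * 2))%:R)); first by rewrite ler1n.
by move=> k; rewrite -natrM ler_nat.
Qed.

(** * Levels of the towers and the implication from (A) to (D) *)

Lemma level_translates n b i x y : (i <= ret n b)%N -> Iv T_[n] b x -> Iv T_[n] b y ->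
  iter i f y = iter i f x + (y - x).
Proof.
elim: n b i x y => [|n IH] b i x y.
  case: i => [|[|//]] _ bx bI; first by rewrite /= addrC subrK.
  by rewrite /= !(iet_mapE Tpos (a := b))//; lra.
have [->|bl] := eqVneq b (lo n); last first.
  rewrite /= (negbTE bl) => ib xI yI.
  have sub z : Iv T_[n.+1] b z -> Iv T_[n] b z.
    have lb := len_next_le b (tw n).
    rewrite /Iv (p_next TK (tw n))// => /andP[-> zb]; apply: (lt_le_trans zb).
    by rewrite lerD2l.
  by apply: IH ib _ _; exact: sub.
move=> ir /Iv_split[u uP ->] /Iv_split[v vP ->].
rewrite (len_lo_next Tpos TK) in uP vP.
have [H1 H2 H3 H4] := tower_step_lo TK (tw n).
set c := if top n then lo n else wi n in H1 H3.
set d := if top n then wi n else lo n in H2 H4.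
have rE : (ret n.+1 (lo n) = ret n d + ret n c)%N.
  by rewrite /= eqxx /c /d; case: (top n); rewrite // addnC.
rewrite rE in ir; have [ic|ci] := leqP i (ret n c).
  by apply: (IH c) => //; exact: H3.
rewrite -(subnK (ltnW ci)) !iterD !H1// (IH d _ _ _ _ (H4 _ uP) (H4 _ vP)); first by lra.
by lia.
Qed.

Definition level n x := exists a i, (i < ret n a)%N /\ x = iter i f (p_ T_[n] a).

Lemma level_gap n x y l : (forall a, l <= len T_[n] a) -> level n x ->
  level n y \/ y = L -> x < y -> x + l <= y.
Proof.
move=> lP [a [i [ia xE]]] yP xy; rewrite leNgt; apply/negP => yx.
have la := lP a; pose u := y - x.
have zI : Iv T_[n] a (p_ T_[n] a + u) by rewrite /Iv /u; lra.
have yE : y = iter i f (p_ T_[n] a + u).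
  rewrite (level_translates (ltnW ia) (Iv_p Tpos TK n a) zI) -xE /u; lra.
have zD := Iv_domain (pos n) zI.
case: yP => [[b [j [jb yE']]]|yL]; last first.
  have : domain T y by rewrite yE iter_domain//; exact: (tw_dom (tw n)).
  by rewrite yL => /andP[_]; rewrite ltxx.
have bI := Iv_p Tpos TK n b; have bD := Iv_domain (pos n) bI.
case: (ltngtP i j) => ij.
- have E : p_ T_[n] a + u = iter (j - i) f (p_ T_[n] b).
    by apply: (iter_inj Tpos (n := i)); rewrite -iterD subnKC ?(ltnW ij)// -yE.
  by apply: (tw_return (tw n) bI (i := j - i)); [lia|rewrite -E].
- have E : p_ T_[n] b = iter (i - j) f (p_ T_[n] a + u).
    by apply: (iter_inj Tpos (n := j)); rewrite -iterD subnKC ?(ltnW ij)// -yE.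
  by apply: (tw_return (tw n) zI (i := i - j)); [lia|rewrite -E].
have E : p_ T_[n] a + u = p_ T_[n] b by apply: (iter_inj Tpos (n := i)); rewrite -yE ij.
have ab : a = b by apply: (Iv_uniq (pos n) zI); rewrite E.
by move: E; rewrite ab /u; lra.
Qed.

Lemma hgt_next_le n b : (hgt n b <= hgt n.+1 b)%N.
Proof. by rewrite /=; case: ifP => // _; rewrite leq_addl. Qed.

Lemma hgt_grow n n' b : (n <= n')%N ->
  p_ T_[n'] b = p_ T_[n] b \/ exists a, (ret n a <= hgt n' b)%N.
Proof.
move=> nn; rewrite -(subnKC nn); elim: (n' - n)%N => [|k IH].
  by left; rewrite addn0.
rewrite addnS; case: IH => [IH|[a aP]]; last first.
  by right; exists a; exact: leq_trans aP (hgt_next_le _ _).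
have [bl|bl] := eqVneq b (lo (n + k)); last by left; rewrite (p_next TK (tw _))// IH.
case: (boolP (top (n + k))) => tn; first by left; rewrite /= p_induction_top// IH.
right; exists (wi (n + k)); rewrite /= tn bl eqxx /=.
exact: (leq_trans (@ret_mono _ _ T _ _ (wi (n + k)) (leq_addr k n)) (leq_addr _ _)).
Qed.

Lemma disc_level n N x : (forall b, (1 < pi_t (data T) b)%N -> (n <= hgt N b)%N) ->
  disc T n x -> level N x \/ x = L.
Proof.
move=> hP /discE[->|->|[xD [j [b [jn b1 jE]]]]]; [left|by right|left].
  have [_ _ surj] := pi_tP (data T_[N]).
  have [|s s1] := surj 1%N; first by rewrite (letters_gt0 (data T)).
  exists s, 0%N; split; first exact: ret_gt0.
  by rewrite /= /p_ -/(cum _ _ _) (cum_first _ (pi_tP _)).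
have hb := hP b b1; exists b, (hgt N b - j)%N; split.
  by have := tw_hgt_lt (tw N) b; lia.
apply: (iter_inj Tpos (n := j)); rewrite -iterD subnKC; last by lia.
by rewrite jE (translates0 (tw N) (tw_hgt (tw N) b)).
Qed.

Lemma Delta_ge n N l : (forall b, (1 < pi_t (data T) b)%N -> (n <= hgt N b)%N) ->
  (forall a, l <= len T_[N] a) -> l <= Delta T n.
Proof.
move=> hP lP; apply: lb_le_inf.
  exists `|L - 0|, L, 0; split=> //; [exact: disc_total|exact: disc_zero|].
  by apply/eqP; rewrite gt_eqF// total_gt0.
move=> _ [x [y [dx dy xy ->]]].
wlog lt : x y dx dy xy / x < y => [H|].
  case: (ltgtP x y) => // lt; first exact: H.
  by rewrite distrC; apply: H => //; exact/nesym.
have yL : y <= L by have /andP[] := disc_range Tpos dy.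
have [xl|xL] := disc_level hP dx; last by move: lt; rewrite xL ltNge yL.
rewrite distrC gtr0_norm ?subr_gt0// lerBrDl.
exact: level_gap lP xl (disc_level hP dy) lt.
Qed.

Lemma small_power (x e : R) : 0 <= x < 1 -> 0 < e -> exists t : nat, x ^+ t < e.
Proof.
move=> /andP[x0 x1] e0; have nx1 : `|x| < 1 by rewrite ger0_norm.
have /cvgrPdist_lt/(_ e e0)[t _ tP] := cvg_expr nx1.
by exists t; have := tP t (leqnn t); rewrite /= sub0r normrN ger0_norm ?exprn_ge0.
Qed.

Lemma total_noninc n n' : (n <= n')%N -> total_len T_[n'] <= total_len T_[n].
Proof.
move=> nn; rewrite -(subnKC nn); elim: (n' - n)%N => [|j]; first by rewrite addn0.
by apply: le_trans; rewrite addnS; exact: total_decr.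
Qed.

Lemma condA_condD : condA T -> condD T.
Proof.
move=> [m mP [M0 M0P]]; pose M := Num.max 1 M0.
have M1 : 1 <= M by rewrite le_max lexx.
have M00 : 0 < M by exact: lt_le_trans M1.
have M0' := ltW M00.
have MP k : mx_norm1 (B T (m k) (m k.+1)) <= M.
  by apply: (le_trans (M0P k)); rewrite le_max lexx orbT.
pose D : R := #|A|%:R; have D1 : 1 <= D by rewrite ler1n (letters_gt0 (data T)).
pose Q := M ^+ mmy_gap * D.
have Q1 : 1 <= Q by rewrite mulr_ege1// exprn_ege1.
have Q0 : 0 < Q by exact: lt_le_trans Q1.
have mm k : (m k <= m k.+1)%N by rewrite ltnW// mmy_lt.
have sS k : (sret (m k.+1))%:R <= M * (sret (m k))%:R.
  by apply: (le_trans (sret_norm _ (mm k))); rewrite ler_wpM2r.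
have sQ k a : (sret (m k))%:R <= Q * (ret (m k) a)%:R by exact: mmy_sret_ret.
have sN k j : (sret (m (k + j)%N))%:R <= M ^+ j * (sret (m k))%:R.
  elim: j => [|j IH]; first by rewrite addn0 expr0 mul1r.
  by rewrite addnS exprS -mulrA; apply: (le_trans (sS _)); rewrite ler_wpM2l.
have totS k j : total_len T_[m k] <= M ^+ j * total_len T_[m (k + j)%N].
  elim: j => [|j IH]; first by rewrite addn0 expr0 mul1r.
  rewrite addnS exprSr -mulrA; apply: (le_trans IH); rewrite ler_wpM2l ?exprn_ge0//.
  apply: (le_trans (total_norm Tpos TK (mm _))); rewrite ler_wpM2r//.
  exact: ltW (total_pos Tpos TK _).
have totQ k a : total_len T_[m k] <= Q * len T_[m k] a.
  apply: (le_trans (totS k mmy_gap)); rewrite /Q -mulrA ler_wpM2l ?exprn_ge0//.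
  have -> : D * len T_[m k] a = \sum_(b : A) len T_[m k] a by rewrite sumr_const mulr_natl.
  rewrite /total_len; apply: ler_sum => b _; exact: mmy_len.
pose th := 1 - Q^-1.
have Qi : 0 < Q^-1 <= 1 by rewrite invr_gt0 Q0 invf_le1.
have th01 : 0 <= th < 1 by rewrite /th; lra.
have totth k : total_len T_[m k.+1] <= th * total_len T_[m k].
  have : total_len T_[m k.+1] <= total_len T_[(m k).+1].
    exact: total_noninc (mmy_lt mP k).
  rewrite total_next => /le_trans; apply; rewrite /th mulrBl mul1r lerD2l lerN2.
  by rewrite mulrC ler_pdivrMr// mulrC.
have totthn k t : total_len T_[m (k + t)%N] <= th ^+ t * total_len T_[m k].
  elim: t => [|t IH]; first by rewrite addn0 expr0 mul1r.
  rewrite addnS exprS -mulrA; apply: (le_trans (totth _)).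
  by rewrite ler_wpM2l//; case/andP: th01.
have [t tP] : exists t : nat, th ^+ t * Q < 1.
  have Qi0 : 0 < Q^-1 by case/andP: Qi.
  have [t tP] := small_power th01 Qi0.
  by exists t; rewrite -ltr_pdivlMr// mul1r.
have hgtP k b : (1 < pi_t (data T) b)%N -> exists a, (ret (m k) a <= hgt (m (k + t)%N) b)%N.
  move=> b1; have kt : (m k <= m (k + t)%N)%N by apply: mmy_mono => //; rewrite leq_addr.
  have [pE|//] := hgt_grow b kt; exfalso.
  have [_ _ surj] := pi_tP (data T_[m k]).
  have [|s s1] := surj 1%N; first by rewrite (letters_gt0 (data T)).
  have : (pi_t (data T_[m k]) s < pi_t (data T_[m k]) b)%N by rewrite s1 (tw_first (tw (m k))).
  move=> /(cum_lt (pi_tP _) (pos (m k))); rewrite (cum_first _ (pi_tP _) s1) add0r.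
  have /andP[_] := domain_p (pos (m (k + t)%N)) b; rewrite pE.
  have := totthn k t; have := totQ k s; have tt0 := total_pos Tpos TK (m k).
  have th0 : 0 <= th ^+ t by rewrite exprn_ge0//; case/andP: th01.
  have ls := pos (m k) s; move=> h1 h2 h3 h4.
  have h5 : th ^+ t * total_len T_[m k] <= th ^+ t * (Q * len T_[m k] s) by rewrite ler_wpM2l.
  have h6 : th ^+ t * Q * len T_[m k] s < 1 * len T_[m k] s. rewrite (ltr_pM2r ls). exact: tP.
  have : p_ T_[m k] b < len T_[m k] s by rewrite mulrA in h5; lra.
  by rewrite ltNge => /negP.
pose c : R := L / (Q * M ^+ t * (M * Q)).
have L0 := total_gt0 Tpos.
have W0 : 0 < Q * M ^+ t * (M * Q).
  exact: (mulr_gt0 (mulr_gt0 Q0 (exprn_gt0 t M00)) (mulr_gt0 M00 Q0)).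
exists c; first exact: divr_gt0.
move=> n n1; have n0 : 0 < n%:R :> R by rewrite ltr0n.
have ex : exists k, [forall a, (n <= ret (m k) a)%N].
  exists (Num.truncn (Q * n%:R)).+1; apply/forallP => a.
  set k := _.+1; have kn : Q * n%:R < k%:R by exact: truncnS_gt.
  have : k%:R <= Q * (ret (m k) a)%:R.
    apply: le_trans (sQ k a); rewrite ler_nat.
    exact: leq_trans (mmy_ge mP k) (sret_ge _ _).
  by move=> /(lt_le_trans kn); rewrite ltr_pM2l// ltr_nat => /ltnW.
case: (ex_minnP ex) => k /forallP kP kmin.
have sn : (sret (m k))%:R <= M * Q * n%:R.
  case: k kP kmin => [|k] kP kmin.
    have DQ : D <= Q by rewrite /Q ler_peMl ?exprn_ege1// (le_trans _ D1).
    have [-> _] := mP; rewrite sret0; apply: (le_trans DQ).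
    by rewrite mulrAC ler_peMl ?mulr_ege1 ?ler1n// ltW.
  have /forallPn[a] : ~~ [forall a, (n <= ret (m k) a)%N].
    by apply/negP => /kmin; rewrite ltnn.
  rewrite -ltnNge => ra; apply: (le_trans (sS k)); rewrite -mulrA ler_wpM2l//.
  by apply: (le_trans (sQ k a)); rewrite ler_wpM2l ?(ltW Q0)// ler_nat ltnW.
apply: (@Delta_ge n (m (k + t)%N)) => [b /(hgtP k)[a] |a].
  exact: leq_trans (kP a).
have := area_ge Tpos TK (m (k + t)%N) => aL.
have la := pos (m (k + t)%N) a.
have {}aL : L <= Q * len T_[m (k + t)%N] a * (M ^+ t * (M * Q * n%:R)).
  apply: (le_trans aL); apply: ler_pM => //; first by rewrite ltW// total_pos.
  by apply: (le_trans (sN k t)); rewrite ler_wpM2l// exprn_ge0.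
rewrite /c ler_pdivrMr// ler_pdivrMr//.
by apply: (le_trans aL); rewrite le_eqVlt; apply/orP; left; apply/eqP; ring.
Qed.

End MarmiMoussaYoccoz.

(** * The Zorich acceleration *)

Section LowerLimit.
Context {R : realType}.
Implicit Types (u : nat -> R) (c e : R).

Lemma limn_einf_ge u c N : (forall n, (N <= n)%N -> c <= u n) ->
  (c%:E <= limn_einf (fun n => (u n)%:E))%E.
Proof.
move=> H; rewrite limn_einf_lim (cvg_lim _ (@cvg_einfs_sup _ _))//.
apply: (@le_trans _ _ (einfs (fun n => (u n)%:E) N)); last by apply: ereal_sup_ubound; exists N.
by apply: le_ereal_inf_tmp => _ [n /= Nn <-]; rewrite lee_fin; exact: H.
Qed.

Lemma limn_einf_le u e : (forall N, exists2 n, (N <= n)%N & u n <= e) ->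
  (limn_einf (fun n => (u n)%:E) <= e%:E)%E.
Proof.
move=> H; rewrite limn_einf_lim (cvg_lim _ (@cvg_einfs_sup _ _))//.
apply: ge_ereal_sup => _ [N _ <-]; have [n Nn un] := H N.
apply: (@le_trans _ _ (u n)%:E); last by rewrite lee_fin.
by apply: ereal_inf_lbound; exists n.
Qed.

End LowerLimit.

Section Zorich.
Context {R : realType} {A : finType} (T : iem R A).
Implicit Types (a b w : A) (x y z c : R) (n k : nat) (t : bool).
Notation "T_[ n ]" := (iem_at T n) (at level 0, format "T_[ n ]").
Notation wi := (wi T). Notation lo := (lo T). Notation top := (top T).
Notation ret := (ret T). Notation hgt := (hgt T). Notation rowpos := (rowpos T).
Notation f := (iet_map T).
Notation L := (total_len T).
Hypotheses (Tpos : pos_len T) (TK : Keane T).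
Let tw n := towersP Tpos TK n.
Let pos n := tw_pos (tw n).

Lemma iter_comm (g : R -> R) m n x : iter m g (iter n g x) = iter n g (iter m g x).
Proof. by rewrite -!iterD addnC. Qed.

Lemma same_winnerP s e : same_winner (gamma T s e) <->
  exists a, forall i, (s <= i < e)%N -> wi i = a.
Proof.
rewrite /same_winner /gamma; split=> -[a p]; exists a.
  by move=> i ise; move: p; rewrite /= all_map => /allP/(_ i); rewrite mem_index_iota => /(_ ise)/eqP.
by rewrite all_map; apply/allP => i; rewrite mem_index_iota => /p /eqP.
Qed.

Lemma Zorich_times_ex : exists n : nat -> nat, Zorich_times T n.
Proof.
apply: (@largest_times (fun s j => same_winner (gamma T s j))) => s.
have [e se we] := wins_often Tpos TK (lo s) s.
apply: (@largest_above_ex _ s e).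
  by apply/same_winnerP; exists (wi s) => i isi; congr wi; lia.
move=> j /same_winnerP[a aP]; rewrite leqNgt; apply/negP => ej.
apply: (wi_neq_lo TK (tw s)); rewrite -we.
have [sj sj'] : (s <= s < j)%N /\ (s <= e < j)%N by lia.
by rewrite (aP _ sj) (aP _ sj').
Qed.

Lemma cum_after (pi : A -> nat) (ln : A -> R) a : is_numbering pi ->
  cum pi ln a + ln a + \sum_(b | (pi a < pi b)%N) ln b = \sum_b ln b.
Proof.
move=> pP; rewrite cumD// [RHS](bigID (fun b => (pi b <= pi a)%N)) /=; congr (_ + _).
by apply: eq_bigl => b; rewrite ltnNge.
Qed.

Section Block.
Context (s l : nat) (w : A).
Hypothesis wP : forall i, (s <= i < s + l)%N -> wi i = w.

Let t := top s.
Let P i := rowpos (~~ t) i.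
Definition shift := \sum_(b | (P s w < P s b)%N) len T_[s] b.

Lemma block_top i : (s <= i < s + l)%N -> top i = t.
Proof.
elim: i => [|i IH] ise; first by rewrite /t; have -> : s = 0%N by lia.
have [<-//|si] := eqVneq s i.+1.
have ti : top i = t by apply: IH; lia.
have wi_ : wi i = w by apply: wP; lia.
have wi1 := wP ise; apply/eqP; apply: contraT => tt.
have := rowpos_last T t i; rewrite ti eqxx wi_ => rw.
have rw' : rowpos t i.+1 w = #|A| by rewrite rowpos_next ti eqxx.
have := rowpos_last T t i.+1; rewrite (negbTE tt) -rw' => /rowpos_inj E.
by case: (wi_neq_lo TK (tw i.+1)); rewrite wi1 E.
Qed.

Lemma block_row_next i b : (s <= i < s + l)%N -> P i.+1 b = move_last (P i w) (P i) b.
Proof.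
by move=> ise; rewrite /P rowpos_next block_top// wP//; case: t.
Qed.

Lemma block_row_last i : (s <= i < s + l)%N -> P i (lo i) = #|A|.
Proof. by move=> ise; rewrite /P; have := rowpos_last T (~~ t) i; rewrite block_top//; case: t. Qed.

Lemma block_after i b : (s <= i <= s + l)%N -> (P s w < P s b)%N -> (P i w < P i b)%N.
Proof.
move=> + wb; elim: i => [|i IH] ise; first by move: wb; have -> : s = 0%N by lia.
have [<-//|si] := eqVneq s i.+1.
have {}IH : (P i w < P i b)%N by apply: IH; lia.
rewrite !block_row_next; [|lia|lia]; have nb : (P i b <= P i w)%N = false by rewrite leqNgt IH.
rewrite /move_last leqnn nb.
by case: ifP; lia.
Qed.

(* The letters after w in the row of the loser move one step at a time to the
   last position, and lose there. *)
Lemma block_loses i b : (s <= i)%N -> (i + #|A| <= s + l)%N -> (P s w < P s b)%N ->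
  exists j : 'I_#|A|, lo (i + j) = b.
Proof.
move=> si il wb; pose k := (#|A| - P i b)%N.
have ib : (P i w < P i b)%N by apply: block_after => //; have := letters_gt0 (data T); lia.
have kA : (k < #|A|)%N by have := letters_gt0 (data T); rewrite /k; lia.
have posj j : (j <= k)%N -> P (i + j) b = (P i b + j)%N.
  elim: j => [|j IH] jk; first by rewrite !addn0.
  rewrite addnS block_row_next; last by lia.
  have {}IH := IH (ltnW jk).
  have bj : (P (i + j) w < P (i + j) b)%N by apply: block_after => //; lia.
  have nb : (P (i + j) b <= P (i + j) w)%N = false by rewrite leqNgt bj.
  rewrite /move_last nb IH; case: ifP; rewrite ?addnS//.
  by move: jk; rewrite /k; lia.
exists (Ordinal kA); apply: (@rowpos_inj _ _ T (~~ t) (i + k)%N).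
rewrite -/(P (i + k)) block_row_last; last by lia.
rewrite posj// /k subnKC//; exact: (numbering_le _ (rowposP _ _ _)).
Qed.

Lemma block_len i b : (s <= i <= s + l)%N -> b != w -> len T_[i] b = len T_[s] b.
Proof.
move=> + bw; elim: i => [|i IH] ise; first by have -> : s = 0%N by lia.
have [<-//|si] := eqVneq s i.+1.
rewrite len_next wP; last by lia.
by rewrite (negbTE bw); apply: IH; lia.
Qed.

Lemma block_round i : (s <= i)%N -> (i + #|A| <= s + l)%N ->
  len T_[(i + #|A|)%N] w <= len T_[i] w - shift.
Proof.
move=> si il.
have lenD k : (k <= #|A|)%N -> len T_[(i + k)%N] w =
    len T_[i] w - \sum_(j < k) len T_[s] (lo (i + j)).
  elim: k => [|k IH] kA; first by rewrite addn0 big_ord0 subr0.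
  have ik : wi (i + k) = w by apply: wP; lia.
  rewrite addnS len_next ik eqxx big_ord_recr /= opprD addrA IH ?(ltnW kA)//.
  congr (_ - _); apply: block_len; first by lia.
  by apply/eqP => E; apply: (wi_neq_lo TK (tw (i + k))); rewrite ik E.
rewrite lenD// lerD2l lerN2.
have -> : \sum_(j < #|A|) len T_[s] (lo (i + j)) =
    \sum_b \sum_(j < #|A|) (b == lo (i + j))%:R * len T_[s] b.
  rewrite exchange_big /=; apply: eq_bigr => j _.
  by rewrite (sum_delta (fun b => len T_[s] b)).
rewrite /shift [X in _ <= X](bigID (fun b => (P s w < P s b)%N)) /=.
apply: (@le_trans _ _ (\sum_(b | (P s w < P s b)%N) \sum_(j < #|A|) (b == lo (i + j))%:R * len T_[s] b)).
  apply: ler_sum => b wb; have [j jb] := block_loses si il wb.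
  rewrite (bigD1 j) //= jb eqxx mul1r lerDl; apply: sumr_ge0 => k _.
  by rewrite mulr_ge0// ltW// pos.
rewrite lerDl; apply: sumr_ge0 => b _; apply: sumr_ge0 => j _.
by rewrite mulr_ge0// ltW// pos.
Qed.

Lemma block_shift K : (K * #|A| <= l)%N -> K%:R * shift < len T_[s] w.
Proof.
move=> Kl; suff : len T_[(s + K * #|A|)%N] w <= len T_[s] w - K%:R * shift.
  by have := pos (s + K * #|A|) w; lra.
elim: K Kl => [|K IH] Kl; first by rewrite mul0n addn0 mul0r subr0.
have {}IH := IH (leq_trans (leq_mul (leqnSn _) (leqnn _)) Kl).
have -> : (s + K.+1 * #|A| = s + K * #|A| + #|A|)%N by rewrite mulSn; lia.
apply: (le_trans (block_round _ _)); [lia|by move: Kl; rewrite mulSn; lia|].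
by rewrite -natr1 mulrDl mul1r; lra.
Qed.

Lemma shift_gt0 : (0 < l)%N -> 0 < shift.
Proof.
move=> l0; rewrite /shift (bigD1 (lo s)) /=.
  by rewrite ltr_pwDl// ?pos//; apply: sumr_ge0 => b _; rewrite ltW// pos.
have ss : (s <= s < s + l)%N by lia.
rewrite block_row_last// ltn_neqAle (numbering_le _ (rowposP _ _ _)) andbT.
apply/eqP => E; apply: (wi_neq_lo TK (tw s)); rewrite wP//.
by apply: (@rowpos_inj _ _ T (~~ t) s); rewrite -/(P s) block_row_last.
Qed.

Lemma block_translation : (0 < l)%N ->
  q_ T_[s] w = if t then p_ T_[s] w - shift else p_ T_[s] w + shift.
Proof.
move=> l0; have ww : wi s = w by apply: wP; lia.
rewrite /shift /P /rowpos /t; case: (boolP (top s)) => [ts|/negbTE ts] /=.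
  have wE : w = alpha_t (data T_[s]) by rewrite -ww /wi /win [top_type _]ts.
  have := p_alpha_t T_[s]; rewrite -wE => ->.
  have := cum_after (len T_[s]) w (pi_bP (data T_[s])).
  by rewrite /q_ /cum /total_len; lra.
have wE : w = alpha_b (data T_[s]) by rewrite -ww /wi /win [top_type _]ts.
have := q_alpha_b T_[s]; rewrite -wE => ->.
have := cum_after (len T_[s]) w (pi_tP (data T_[s])).
by rewrite /p_ /cum /total_len; lra.
Qed.

End Block.

(* Near recurrence caused by a long block of wins of [w], seen from the left
   endpoint of the interval of [w] at step 0. *)
Definition near_return (K : nat) t w := exists r (d l : R),
  [/\ (0 < r)%N, 0 < d, K%:R * d < l, r%:R * l <= L &
    if t then forall u, 0 <= u < l - d -> iter r f (p_ T w + d + u) = p_ T w + u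
    else iter r f (p_ T w) = p_ T w + d].

Lemma near_return_block K s l w : (forall i, (s <= i < s + l)%N -> wi i = w) ->
  (0 < K)%N -> (K * #|A| <= l)%N -> near_return K (top s) w.
Proof.
move=> wP K0 Kl; have l0 : (0 < l)%N by apply: leq_trans Kl; rewrite muln_gt0 K0 (letters_gt0 (data T)).
have d0 := shift_gt0 wP l0; have Kd := block_shift wP Kl.
have qE := block_translation wP l0; set d := shift s w in d0 Kd qE *.
exists (ret s w), d, (len T_[s] w); split => //; first exact: ret_gt0.
  by rewrite mulrC; exact: area_le.
have dl : d < len T_[s] w by apply: le_lt_trans Kd; rewrite ler_peMl ?ler1n// ltW.
have hP := tw_hgt (tw s) w; have rP := tw_ret (tw s) w.
case: ifP qE => _ qE.
  move=> u /andP[u0 ul].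
  have <- : iter (hgt s w) f (p_ T_[s] w + (d + u)) = p_ T w + d + u.
    by rewrite hP ?addrA//; lra.
  rewrite iter_comm rP ?qE; last by lra.
  have -> : p_ T_[s] w - d + (d + u) = p_ T_[s] w + u by lra.
  by apply: hP; lra.
have <- : iter (hgt s w) f (p_ T_[s] w + 0) = p_ T w.
  by rewrite hP ?addr0// lexx pos.
rewrite iter_comm rP ?qE; last by rewrite lexx pos.
have -> : p_ T_[s] w + d + 0 = p_ T_[s] w + d by lra.
by rewrite !hP; lra.
Qed.

End Zorich.

Section Recurrent.
Context {R : realType} {A : finType} (T : iem R A).
Implicit Types (a b w : A) (x y z c : R) (n k : nat) (t : bool).
Notation f := (iet_map T).
Notation L := (total_len T).
Hypotheses (Tpos : pos_len T) (Tadm : admissible (data T)) (TK : Keane T).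

Definition recurrent x := forall e : R, 0 < e ->
  exists2 n, (0 < n)%N & n%:R * `|iter n f x - x| < e.

Lemma recurrent_not_condU x : domain T x -> recurrent x -> ~ condU T.
Proof.
move=> xD rx [c c0 /(_ x xD)]; apply/negP; rewrite -ltNge.
suff H N : exists2 n, (N <= n)%N & n%:R * `|iter n f x - x| <= c / 2%:R.
  by apply: le_lt_trans (limn_einf_le H) _; rewrite lte_fin; lra.
have [d d0 dP] : exists2 d : R, 0 < d &
    forall n, (0 < n < N)%N -> d <= n%:R * `|iter n f x - x|.
  elim: N => [|N [d d0 dP]]; first by exists 1 => // n; lia.
  have [->|N0] := posnP N; first by exists 1 => // n; lia.
  have N1 : 0 < N%:R * `|iter N f x - x|.
    by rewrite mulr_gt0 ?ltr0n// normr_gt0 subr_eq0; apply/eqP; exact: aperiodic.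
  exists (Num.min d (N%:R * `|iter N f x - x|)); first by rewrite lt_min d0.
  move=> n /andP[n0]; rewrite ltnS leq_eqVlt => /orP[/eqP ->|nN].
    by rewrite ge_min lexx orbT.
  by rewrite ge_min dP// n0.
have [n n0 nP] := rx (Num.min d (c / 2%:R)) ltac:(by rewrite lt_min d0 divr_gt0).
rewrite lt_min in nP; case/andP: nP => nd nc.
exists n; last exact: ltW.
by rewrite leqNgt; apply/negP => nN; have := dP n; rewrite n0 nN leNgt nd => /(_ isT).
Qed.

Lemma near_return_small t w (e : R) : (forall K, (0 < K)%N -> near_return T K t w) -> 0 < e ->
  exists r (d l : R), [/\ (0 < r)%N, 0 < d, d < l, r%:R * d < e &
    if t then forall u, 0 <= u < l - d -> iter r f (p_ T w + d + u) = p_ T w + u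
    else iter r f (p_ T w) = p_ T w + d].
Proof.
move=> H e0; have [r [d [l [r0 d0 Kd rl tP]]]] := H (Num.truncn (L / e)).+1 isT.
exists r, d, l; set K := _.+1 in Kd.
have LK : L < K%:R * e by rewrite -ltr_pdivrMr//; exact: truncnS_gt.
have K1 : 1 <= K%:R :> R by rewrite ler1n.
have K0 : 0 < K%:R :> R by exact: lt_le_trans K1.
split=> //; first by apply: le_lt_trans Kd; rewrite ler_peMl// ltW.
rewrite -(ltr_pM2l K0) (le_lt_trans _ LK)//.
by apply: le_trans rl; rewrite mulrCA ler_wpM2l// ltW.
Qed.

Lemma near_return_mono K K' t w : (K <= K')%N -> near_return T K' t w -> near_return T K t w.
Proof.
move=> KK [r [d [l [r0 d0 Kd rl tP]]]]; exists r, d, l; split => //.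
by apply: le_lt_trans Kd; rewrite ler_wpM2r ?ler_nat// ltW.
Qed.

Lemma recurrent_bottom w :
  (forall K, (0 < K)%N -> near_return T K false w) -> recurrent (p_ T w).
Proof.
move=> H e e0; have [r [d [l [r0 d0 dl rd E]]]] := near_return_small H e0.
by exists r => //; rewrite E addrAC subrr add0r gtr0_norm.
Qed.

(* Here only the backward orbit of p_w is recurrent. The recurrent point is
   p_w + sum_j d_j for a rapidly decreasing sequence of the distances d_j: the
   iterate of exponent r_0 + ... + r_(j-1) moves it to
   p_w + d_j + d_(j+1) + ..., and f^(r_j) translates that point by - d_j. *)
Lemma recurrent_top w : (forall K, (0 < K)%N -> near_return T K true w) ->
  exists2 x, domain T x & recurrent x.
Proof.
move=> H; set p := p_ T w.
have /choice[g gP] (e : R) : exists g : nat * R * R, 0 < e ->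
    [/\ (0 < g.1.1)%N, 0 < g.1.2 < e, g.1.1%:R * g.1.2 < e, 0 < g.2 &
      forall u, 0 <= u < g.2 -> iter g.1.1 f (p + g.1.2 + u) = p + u].
  have [e0|e0] := ltP 0 e; last by exists (0%N, 0, 0) => e1; lra.
  have [r [d [l [r0 d0 dl rd E]]]] := near_return_small H e0.
  exists (r, d, l - d) => _; split => //=; last by rewrite subr_gt0.
  by rewrite d0 (le_lt_trans _ rd)// ler_peMl ?ler1n// ltW.
pose delta j E : R := Num.min (E / 2%:R) (j.+1%:R)^-1.
pose step j (st : nat * R * R) := let h := g (delta j st.2) in
  ((st.1.1 + h.1.1)%N, st.1.2 + h.1.2, Num.min (st.2 - h.1.2) h.2 / 2%:R).
pose st := fix st j := if j is i.+1 then step i (st i) else (0%N, 0, 1).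
pose S j := (st j).1.1; pose X j := (st j).1.2; pose E j := (st j).2.
pose h j := g (delta j (E j)).
have SE j : S j.+1 = (S j + (h j).1.1)%N by [].
have XE j : X j.+1 = X j + (h j).1.2 by [].
have EE j : E j.+1 = Num.min (E j - (h j).1.2) (h j).2 / 2%:R by [].
have delta0 j : 0 < E j -> 0 < delta j (E j).
  by move=> Ej; rewrite lt_min divr_gt0 //= invr_gt0 ltr0n.
have E0 j : 0 < E j.
  elim: j => [|j IH]; first exact: ltr01.
  have [_ /andP[h0 hd] _ h2 _] := gP _ (delta0 j IH).
  rewrite -/(h j) in h0 hd h2; rewrite EE divr_gt0// lt_min h2 andbT.
  by move: hd; rewrite lt_min => /andP[]; lra.
have hP j : [/\ (0 < (h j).1.1)%N, 0 < (h j).1.2, (h j).1.2 < E j / 2%:R,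
    (h j).1.1%:R * (h j).1.2 < (j.+1%:R)^-1 &
    forall u, 0 <= u < (h j).2 -> iter (h j).1.1 f (p + (h j).1.2 + u) = p + u].
  have [r0 /andP[d0 dd] rd _ fP] := gP _ (delta0 j (E0 j)).
  rewrite -/(h j) in r0 d0 dd rd fP.
  by split => //; [move: dd|move: rd]; rewrite lt_min => /andP[].
have Es j : E j.+1 < E j - (h j).1.2 /\ E j.+1 < (h j).2.
  have [_ d0 dE _ _] := hP j; have := E0 j.+1; rewrite EE.
  by case: (leP (E j - (h j).1.2) (h j).2); lra.
have nest j : X j.+1 + E j.+1 < X j + E j by have [] := Es j; rewrite XE; lra.
have Xinc j : X j < X j.+1 by have [] := hP j; rewrite XE; lra.
have Xmono i k : X i <= X (i + k)%N.
  by elim: k => [|k]; rewrite ?addn0// addnS => /le_trans; apply; exact: ltW.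
have nests i k : X (i + k)%N + E (i + k)%N <= X i + E i.
  elim: k => [|k]; first by rewrite addn0.
  by apply: le_trans; rewrite addnS ltW.
have XlE i j : X i <= X j + E j.
  have [ij|ji] := leqP i j.
    by have := Xmono i (j - i)%N; rewrite subnKC//; have := E0 j; lra.
  by have := nests j (i - j)%N; rewrite subnKC ?(ltnW ji)//; have := E0 i; lra.
pose x := sup (range X).
have Xx j : X j <= x.
  apply: ub_le_sup; last by exists j.
  by exists (X 0%N + E 0%N) => _ [i _ <-].
have xX j : x < X j + E j.
  apply: le_lt_trans (nest j); apply: ge_sup; first by exists (X 0%N), 0%N.
  by move=> _ [i _ <-].
have inv j u : 0 <= u < E j -> iter (S j) f (p + X j + u) = p + u.
  elim: j u => [|j IH] u; first by rewrite /S /X /= addr0.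
  move=> /andP[u0 uE]; have [_ d0 dE _ fP] := hP j; have [E1 E2] := Es j.
  rewrite SE addnC iterD XE.
  have -> : p + (X j + (h j).1.2) + u = p + X j + ((h j).1.2 + u) by lra.
  by rewrite IH; [rewrite addrA fP//|]; lra.
have ret_x j : iter (h j).1.1 f (p + x) = p + x - (h j).1.2.
  have [_ d0 dE _ fP] := hP j; have [E1 E2] := Es j.
  have := Xx j.+1; have := xX j.+1; rewrite XE => x1 x2.
  apply: (iter_inj Tpos (n := S j)); rewrite iter_comm.
  have -> : p + x = p + X j + (x - X j) by lra.
  rewrite inv; last by lra.
  have -> : p + (x - X j) = p + (h j).1.2 + (x - X j - (h j).1.2) by lra.
  rewrite fP; last by lra.
  have -> : p + X j + (x - X j) - (h j).1.2 = p + X j + (x - X j - (h j).1.2) by lra.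
  by rewrite inv//; lra.
exists (p + x).
  apply: contrapT => xD; have [_ d0 _ _ _] := hP 0%N.
  have out n : iter n f (p + x) = p + x.
    by elim: n => //= n ->; exact: iet_map_out.
  by have := ret_x 0%N; rewrite out; lra.
move=> e e0; pose j := Num.truncn e^-1.
have [r0 d0 _ rd _] := hP j; exists (h j).1.1 => //.
rewrite ret_x addrAC subrr sub0r normrN gtr0_norm//; apply: lt_trans rd _.
by rewrite invf_plt ?posrE ?ltr0n//; exact: truncnS_gt.
Qed.

Lemma condU_condZ : condU T -> condZ T.
Proof.
move=> TU; have [n nP] := Zorich_times_ex Tpos TK.
have nlt k : (n k < n k.+1)%N by have [_ /(_ k)[]] := nP.
have same k : exists w, forall i, (n k <= i < n k + (n k.+1 - n k))%N -> wi T i = w.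
  by have [_ /(_ k)[_ /same_winnerP]] := nP; rewrite subnKC// ltnW.
exists n => //; apply: contrapT => unb.
have long K : exists2 k, (K <= n k.+1 - n k)%N & True.
  apply: contrapT => nK; apply: unb; exists (#|A| + K)%:R => k.
  have [w wP] := same k; rewrite subnKC in wP; last exact: ltnW.
  rewrite (norm_same_winner Tpos TK (ltnW (nlt k)) wP) ler_nat leq_add2l leqNgt.
  by apply/negP => /ltnW kK; apply: nK; exists k.
have [[t w] /= H] : exists tw : bool * A, forall K, (0 < K)%N -> near_return T K tw.1 tw.2.
  apply: contrapT => nH.
  have [|K KP] := @eventually_all _ (fun (tw : bool * A) K => ~ near_return T K tw.1 tw.2).
    move=> tw; apply: contrapT => ntw; apply: nH; exists tw => K K0.
    apply: contrapT => nK; apply: ntw; exists K => i Ki; apply: contra_not nK.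
    exact: near_return_mono.
  have [k kK _] := long (K.+1 * #|A|)%N; have [w wP] := same k.
  have := near_return_block Tpos TK wP (ltn0Sn K) kK.
  exact: (KP K.+1 (leqnSn K) (top T (n k), w)).
case: t H => H; last exact: (recurrent_not_condU (domain_p Tpos w) (recurrent_bottom H)).
by have [x xD rx] := recurrent_top H; exact: (recurrent_not_condU xD rx).
Qed.

Lemma separated_condU c : 0 < c -> disc_separated T c -> condU T.
Proof.
move=> c0 sep; exists (c / 2%:R); first by rewrite divr_gt0.
move=> x xD; apply: (@limn_einf_ge _ _ _ 1%N) => n n0.
have := recurrence_lower Tpos Tadm TK c0 sep xD n0.
have nn : 0 < n%:R :> R by rewrite ltr0n.
rewrite -(ler_pM2l nn); apply: le_trans; rewrite le_eqVlt; apply/orP; left; apply/eqP.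
by rewrite natrD; field; rewrite gt_eqF// addr_gt0.
Qed.

End Recurrent.

Theorem mainTheorem1 (R : realType) (A : finType) (T : iem R A)
    (Tpos : pos_len T) (Tadm : admissible (data T)) (TK : Keane T) :
  (condA T <-> condD T) /\
  (condD T -> condU T) /\
  (condU T -> condZ T).
Proof.
split; [split; [exact: condA_condD|]|split; [|exact: condU_condZ]];
  move=> [c c0 /(condD_separated)].
- exact: separated_condA.
- exact: separated_condU.
Qed.
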